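(* Let $\alpha>0$, $p>0$, $\gamma>0$. Let $\lambda=\lambda_n=\Theta(n^{-p})$, let $\varepsilon(\lambda)=\Theta(\lambda^\gamma)$, and suppose that the average upper rate with respect to the number $n$ of samples, independently and identically drawn according to $\rho$, is $n^{-\alpha}$, i.e. $$\mathbb E\left(\|\hat f^{\lambda_n}_n-f^\dagger\|^2\right)\in O\left(\left(\tfrac1n\right)^{\alpha}\right).$$ Then the upper rate of the error with respect to the noise level $\delta\to0$ is given by $$\|f^\lambda_\delta-f^\dagger\|^2\in\begin{cases}O\left(\delta^{2\alpha}\right)&\text{if }p\gamma\ge\frac12,\\ O\left(\delta^{\frac{\alpha}{1-p\gamma}}\right)&\text{if }p\gamma<\frac12,\end{cases}$$ where $f^\lambda_\delta=L^\lambda y^\delta$, $y^\delta$ is such that $\|y^\delta-y\|\le\delta$, and $\lambda=\lambda_\delta$ is the parameter choice associated with $\lambda_n$ (defined in the context), which has the rate $$\lambda_\delta\in\begin{cases}\Theta\left(\delta^{2p}\right)&\text{if }p\gamma\ge\frac12,\\ \Theta\left(\delta^{\frac{p}{1-p\gamma}}\right)&\text{if }p\gamma<\frac12.\end{cases}$$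
   Context: Setting. $\mathcal H_1=L^2(\mathcal T,\mu)$ for a measure space $(\mathcal T,\Theta,\mu)$ and $\mathcal H_2=L^2(\mathcal X,\nu)$ for a measure space $(\mathcal X,\Sigma,\nu)$; $A:\mathcal H_1\to\mathcal H_2$ is a bounded linear operator. $(L^\lambda)_{\lambda>0}$ is a family of linear regularization operators $\mathcal H_2\to\mathcal H_1$ for $A$, of the form $L^\lambda z=\int_{\mathcal X}\ell^\lambda_x\,z(x)\,d\nu(x)$, where $\ell^\lambda_x\in\mathcal H_1$ for each $x$, $\ell^\lambda_x(t)=\ell^\lambda(x,t)$, $\ell^\lambda(\cdot,t)\in\mathcal H_2$ for each $t\in\mathcal T$, and $\sup_{t\in\mathcal T}\|\ell^\lambda(\cdot,t)\|_{\mathcal H_2}<\infty$. $\|\cdot\|_{HS}$ is the Hilbert–Schmidt norm. $f^\lambda=L^\lambda y$, $f^\lambda_\delta=L^\lambda y^\delta$, and $\hat f^\lambda_n=\frac1n\sum_{i=1}^n\ell^\lambda_{X_i}Y_i$. Samples. The observations $(X_i,Y_i)$, $i=1,\dots,n$, are i.i.d. from a probability distribution $\rho$ on a Borel space $\mathcal X\times\mathcal Y$, $\mathcal Y\subseteq\mathbb R$, with marginal $\nu$ on $\mathcal X$; for $\nu$-almost every $x$, $\mathbb E(Y|X=x)=Af^\dagger(x)=y(x)$, where $f^\dagger\in\mathcal H_1$ is the generalized (minimum-norm least-squares) solution of $y=Af$, and $Var(Y|X=x)=\sigma^2$ with $\sigma$ constant. $\mathbb E$ is the expectation with respect to $\rho^{\otimes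 n}$. Notation. $\varepsilon(\lambda)=\|f^\lambda-f^\dagger\|\,\|L^\lambda\|_{HS}^{-1}$ (asymptotics as $\lambda\to0$), $$\Delta(n,\lambda)=\frac{1}{\sqrt{\frac{\sigma^2}{n}+\varepsilon(\lambda)^2}+\varepsilon(\lambda)}\,\frac{\sigma^2}{n},\qquad N(\delta,\lambda)=\frac{\sigma^2}{\delta^2+2\delta\varepsilon(\lambda)}.$$ For a choice $\lambda_n$ put $\tilde\delta(n):=\Delta(n,\lambda_n)$; for a choice $\lambda_\delta$ put $\tilde n(\delta):=\lfloor N(\delta,\lambda_\delta)\rfloor$. Write $\lambda_n=\Lambda^n(n)$ and $\lambda_\delta=\Lambda^\delta(\delta)$. The parameter choice $\lambda_\delta$ associated with a given $\lambda_n$ is the one such that $\tilde\delta\circ\tilde n=id_{\Im(\tilde\delta)}$, where $\Im(\tilde\delta)=\{\delta>0 : \frac{\sigma^2}{\delta^2+2\delta\varepsilon(\lambda_\delta)}\in\mathbb N\}$, and $\Lambda^n=\Lambda^\delta\circ\tilde\delta$ (equivalently $\lambda_\delta=\Lambda^n(\tilde n(\delta))$); it then also satisfies $\tilde n\circ\tilde\delta=id_{\mathbb N}$. $O,\Theta$ are the usual Landau symbols ($n\to\infty$, respectively $\delta\to0$). *)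

(* Defs.v *)
From HB Require Import structures.
From mathcomp Require Import all_boot all_order all_algebra.
From mathcomp Require Import all_classical all_reals all_analysis.

Set Implicit Arguments.
Unset Strict Implicit.
Unset Printing Implicit Defensive.
Import Order.TTheory GRing.Theory Num.Theory.
Import numFieldNormedType.Exports.
Local Open Scope classical_set_scope.
Local Open Scope ring_scope.

(* Elements of L^2(T, mu) are handled through representatives: measurable
   functions [f : T -> R] with [f \in Lfun mu 2%:E].  Identities between
   elements of L^2 are a.e. identities, and [L2norm] is the L^2 norm of the
   class of [f] (a seminorm on representatives). *)
Section L2.
Context {R : realType} {d : measure_display} {T : measurableType d}.
Variable mu : {measure set T -> \bar R}.

Definition L2norm (f : T -> R) : R := fine ('N[mu]_2%:E[EFin \o f])%E.

Definition L2inner (f g : T -> R) : R := \int[mu]_t (f t * g t).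

Record orthonormal_basis (I : choiceType) (e : I -> T -> R) : Prop := {
  onb_L2 : forall i, e i \in Lfun mu 2%:E ;
  onb_orthonormal : forall i j, L2inner (e i) (e j) = (i == j)%:R ;
  onb_total : forall z, z \in Lfun mu 2%:E -> forall eta : R, 0 < eta ->
    exists (s : seq I) (c : I -> R),
      L2norm (fun t => z t - \sum_(i <- s) c i * e i t) < eta }.

End L2.

Section operators.
Context {R : realType} {dT dX : measure_display}.
Context {T : measurableType dT} {X : measurableType dX}.
Variables (mu : {measure set T -> \bar R}) (nu : {measure set X -> \bar R}).

Record bounded_linear_L2 (A : (T -> R) -> (X -> R)) : Prop := {
  bl_L2 : forall f, f \in Lfun mu 2%:E -> A f \in Lfun nu 2%:E ;
  bl_linear : forall (a : R) f g,
    f \in Lfun mu 2%:E -> g \in Lfun mu 2%:E ->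
    A (fun t => a * f t + g t) = (fun x => a * A f x + A g x) %[ae nu] ;
  bl_bounded : exists C : R, forall f, f \in Lfun mu 2%:E ->
    L2norm nu (A f) <= C * L2norm mu f }.

Definition least_squares_solution (A : (T -> R) -> (X -> R)) (z : X -> R)
    (f : T -> R) : Prop :=
  f \in Lfun mu 2%:E /\
  forall g, g \in Lfun mu 2%:E ->
    L2norm nu (A f \- z) <= L2norm nu (A g \- z).

Definition generalized_solution (A : (T -> R) -> (X -> R)) (z : X -> R)
    (f : T -> R) : Prop :=
  least_squares_solution A z f /\
  forall g, least_squares_solution A z g -> L2norm mu f <= L2norm mu g.

(* The integral of the H_1-valued function x |-> z(x) l_x, read pointwise. *)
Definition kernel_op (l : X -> T -> R) (z : X -> R) : T -> R :=
  fun t => \int[nu]_x (l x t * z x).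

(* The first clause (joint measurability) is what makes x |-> l_x a measurable
   H_1-valued map, i.e. what gives a meaning to \int l_x z(x) dnu(x). *)
Record L2_kernel (l : X -> T -> R) : Prop := {
  kernel_meas : measurable_fun [set: X * T] (fun p : X * T => l p.1 p.2) ;
  kernel_L2T : forall x, l x \in Lfun mu 2%:E ;
  kernel_L2X : forall t, l ^~ t \in Lfun nu 2%:E ;
  kernel_bounded : exists C : R, forall t, L2norm nu (l ^~ t) <= C }.

(* The generalized solution f of A f = z exists exactly when z lies in the
   domain of the Moore-Penrose inverse of A, and then f is its value at z. *)
Record regularization_family (A : (T -> R) -> (X -> R))
    (ell : R -> X -> T -> R) : Prop := {
  reg_kernel : forall l : R, 0 < l -> L2_kernel (ell l) ;
  reg_L2 : forall l : R, 0 < l -> forall z, z \in Lfun nu 2%:E ->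
    kernel_op (ell l) z \in Lfun mu 2%:E ;
  reg_bounded : forall l : R, 0 < l -> exists C : R,
    forall z, z \in Lfun nu 2%:E ->
      L2norm mu (kernel_op (ell l) z) <= C * L2norm nu z ;
  reg_cvg : forall z f, z \in Lfun nu 2%:E -> generalized_solution A z f ->
    L2norm mu (kernel_op (ell l) z \- f) @[l --> 0^'+] --> (0 : R) }.

(* Here [e] is meant to be an orthonormal basis of L^2(X, nu); the value does
   not depend on which one.  If L is not Hilbert-Schmidt the sum is +oo, hence
   the norm is 0 and so is its inverse, in accordance with 1/oo = 0. *)
Definition HSnorm (I : choiceType) (e : I -> X -> R)
    (L : (X -> R) -> (T -> R)) : R :=
  Num.sqrt (fine
    (\esum_(i in [set: I]) ('N[mu]_2%:E[EFin \o L (e i)] ^+ 2))%E).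

Definition eps (I : choiceType) (e : I -> X -> R) (ell : R -> X -> T -> R)
    (y : X -> R) (fdag : T -> R) (l : R) : R :=
  L2norm mu (kernel_op (ell l) y \- fdag) * (HSnorm e (kernel_op (ell l)))^-1.

End operators.

Section sampling.
Context {R : realType} {dT dX dO : measure_display}.
Context {T : measurableType dT} {X : measurableType dX} {Om : measurableType dO}.

Definition is_marginal (rho : probability (X * measurableTypeR R)%type R)
    (nu : probability X R) : Prop :=
  forall B, measurable B -> nu B = rho (fst @^-1` B).

(* [g x] is a version of E(Z | X = x), in the sense of Kolmogorov. *)
Record is_cond_exp (rho : probability (X * measurableTypeR R)%type R)
    (nu : probability X R) (Z : X * R -> R) (g : X -> R) : Prop := {
  ce_integrable : rho.-integrable setT (EFin \o Z) ;
  ce_integrable_cond : nu.-integrable setT (EFin \o g) ;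
  ce_eq : forall B : set X, measurable B ->
    \int[rho]_(p in fst @^-1` B) Z p = \int[nu]_(x in B) g x }.

(* E(Y | X = x) = y x  and  Var(Y | X = x) = sigma^2, for nu-almost every x. *)
Definition regression_model (rho : probability (X * measurableTypeR R)%type R)
    (nu : probability X R) (y : X -> R) (sigma : R) : Prop :=
  is_cond_exp rho nu snd y /\
  is_cond_exp rho nu (fun p => (p.2 - y p.1) ^+ 2) (cst (sigma ^+ 2)).

(* Independence is tested on the initial segments of the sequence only; taking
   some of the [B i] equal to [setT] gives every finite subfamily. *)
Record iid_sample (P : probability Om R)
    (rho : probability (X * measurableTypeR R)%type R)
    (Z : nat -> {RV P >-> (X * measurableTypeR R)%type}) : Prop := {
  iid_law : forall i B, measurable B -> P (Z i @^-1` B) = rho B ;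
  iid_indep : forall (n : nat) (B : nat -> set (X * measurableTypeR R)),
    (forall i, measurable (B i)) ->
    P (\bigcap_(i < n) (Z i @^-1` B i)) =
      (\prod_(i < n) P (Z i @^-1` B i))%E }.

(* The observations (X_1, Y_1), ..., (X_n, Y_n) are Z 0, ..., Z n.-1. *)
Definition fhat (P : probability Om R)
    (Z : nat -> {RV P >-> (X * measurableTypeR R)%type})
    (l : X -> T -> R) (n : nat) (w : Om) : T -> R :=
  fun t => n%:R^-1 * \sum_(i < n) l (Z i w).1 t * (Z i w).2.

(* The expectation of ||fhat_n - fdag||^2 over the samples, for the kernel [l]. *)
Definition risk (mu : {measure set T -> \bar R}) (P : probability Om R)
    (Z : nat -> {RV P >-> (X * measurableTypeR R)%type})
    (l : X -> T -> R) (fdag : T -> R) (n : nat) : \bar R :=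
  ('E_P[(fun w => L2norm mu (fhat Z l n w \- fdag)%R ^+ 2)%R])%E.

End sampling.

Section parameter_choice.
Context {R : realType}.
Variables (sigma : R) (ep : R -> R).

Definition Delta (n : nat) (l : R) : R :=
  (Num.sqrt (sigma ^+ 2 / n%:R + ep l ^+ 2) + ep l)^-1 * (sigma ^+ 2 / n%:R).

Definition Nsamples (delta l : R) : R :=
  sigma ^+ 2 / (delta ^+ 2 + 2 * delta * ep l).

Definition delta_tilde (Ln : nat -> R) (n : nat) : R := Delta n (Ln n).

(* [Num.truncn] is the floor, as [Nsamples] is nonnegative where it is used. *)
Definition n_tilde (Ld : R -> R) (delta : R) : nat :=
  Num.truncn (Nsamples delta (Ld delta)).

Definition Im_delta_tilde (Ld : R -> R) : set R :=
  [set delta | 0 < delta /\ Nsamples delta (Ld delta) \is a Num.nat].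

(* The first two clauses do not constrain [Ld] outside of the countable set
   [Im_delta_tilde Ld]; there, [Ld] is given by the third one.  It is required
   for small noise levels only, because n_tilde delta = 0 for large ones and
   [Ln] has no meaning at 0. *)
Record associated_choice (Ln : nat -> R) (Ld : R -> R) : Prop := {
  assoc_id : forall delta, Im_delta_tilde Ld delta ->
    delta_tilde Ln (n_tilde Ld delta) = delta ;
  assoc_comp : forall n, (0 < n)%N -> Ln n = Ld (delta_tilde Ln n) ;
  assoc_choice : \forall delta \near 0^'+, Ld delta = Ln (n_tilde Ld delta) }.

End parameter_choice.

(* Main.v *)
Require Import Defs.
From HB Require Import structures.
From mathcomp Require Import all_boot all_order all_algebra.
From mathcomp Require Import all_classical all_reals all_analysis.
From mathcomp Require Import measurable_realfun ring lra.

(** The theorem compares a random error, that of the estimator computed from n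
    independent samples, with the deterministic worst-case error at noise level
    delta.  Write lambda for the regularization parameter,
    e = eps(lambda) = ||L y - fdag|| / ||L||_HS and V = sigma^2.

    Sampling.  Conditionally on the design points the responses have variance
    V, hence the bias-variance decomposition of the estimator gives
    [[
      E ||fhat_n - fdag||^2  >=  ||L y - fdag||^2 + (V / n) ||L||_HS^2
                              =  ||L||_HS^2 (e^2 + V / n)
    ]]
    ([risk_ge]).  The last equality uses ||L||_HS <> 0, which holds for small lambda
    because e > 0 there.  Noise.  If ||yd - y|| <= delta, the triangle inequality and
    ||L|| <= ||L||_HS ([L2norm_kernel_op_le]) give
    [[
      ||L yd - fdag||^2  <=  (||L||_HS delta + ||L y - fdag||)^2
                          =  ||L||_HS^2 (delta + e)^2.
    ]]
    The number of samples associated with delta is the integer part of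
    V / (delta^2 + 2 delta e), so that (delta + e)^2 <= e^2 + V / n
    ([n_tilde_bounds]): the squared deterministic error is at most the risk
    for n = n_tilde(delta) samples, which is O(n^-alpha).

    What remains is to express n in terms of delta.  First n_tilde(delta) tends
    to infinity ([n_tilde_large]); then lambda = Theta(n^-p) is small,
    e = Theta(n^(-p gamma)), and 1/n is comparable with
    delta^2 + delta n^(-p gamma).  When p gamma >= 1/2 the first term decides
    and 1/n = Theta(delta^2) ([rate_fast]); when p gamma < 1/2 the second one
    does and n^-(1 - p gamma) = Theta(delta) ([rate_slow]).

    The risk bound is obtained for one t at a time.  For a kernel section
    g = l(., t), the second moment of the sample mean of g(X) Y, recentred, is
    bounded below by testing it against an explicit square-integrable variable
    ([second_moment_ge]); this avoids computing a variance, which may be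
    infinite since g(X) Y is only integrable.  The bound in t is then
    integrated over T: mu may fail to be sigma-finite, but the lower bound is
    integrable, so it lives on a countable union of sets of finite measure and
    the theorem of Tonelli applies on each of them ([tonelli_lower_bound]). *)

Set Implicit Arguments.
Unset Strict Implicit.
Unset Printing Implicit Defensive.
Import Order.TTheory GRing.Theory Num.Theory.
Import numFieldNormedType.Exports.
Local Open Scope classical_set_scope.
Local Open Scope ring_scope.

(** * The L2 seminorm on representatives *)

Section L2_seminorm.
Context {R : realType} {d : measure_display} {T : measurableType d}.
Variable mu : {measure set T -> \bar R}.
Implicit Types f g : T -> R.

Lemma Lfun2_measurable f : f \in Lfun mu 2%:E -> measurable_fun setT f.
Proof. by move=> /andP[/[!inE]]. Qed.

Lemma Lfun2D f g : f \in Lfun mu 2%:E -> g \in Lfun mu 2%:E ->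
  f \+ g \in Lfun mu 2%:E.
Proof. by move=> fL gL; exact: (Lfun_addr_closed mu (lee1n 2)).2. Qed.

Lemma Lfun2Z (a : R) f : f \in Lfun mu 2%:E ->
  (fun t => a * f t) \in Lfun mu 2%:E.
Proof.
move=> fL; rewrite (_ : (fun _ => _) = a \o* f).
  by apply: Lfun_scale => //; rewrite ler1n.
by apply/funext => t /=; rewrite mulrC.
Qed.

Lemma Lfun2B f g : f \in Lfun mu 2%:E -> g \in Lfun mu 2%:E ->
  f \- g \in Lfun mu 2%:E.
Proof.
move=> fL /(Lfun2Z (-1)) /(Lfun2D fL).
by under [X in X \in _]eq_fun do rewrite mulN1r.
Qed.

Lemma Lfun2_sum (J : Type) (s : seq J) (h : J -> T -> R) :
  (forall j, h j \in Lfun mu 2%:E) ->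
  (fun t => \sum_(j <- s) h j t) \in Lfun mu 2%:E.
Proof.
move=> hL; elim: s => [|j s ih].
  rewrite (_ : (fun _ => _) = (0 : T -> R)).
    exact: (Lfun_addr_closed mu (lee1n 2)).1.
  by apply/funext => t; rewrite big_nil.
rewrite (_ : (fun _ => _) = h j \+ (fun t => \sum_(j <- s) h j t)).
  exact: Lfun2D.
by apply/funext => t; rewrite big_cons.
Qed.

Lemma Lfun2P f : measurable_fun setT f ->
  (\int[mu]_t ((f t ^+ 2)%:E) < +oo)%E -> f \in Lfun mu 2%:E.
Proof.
move=> mf f2; apply/andP; split; rewrite inE//=.
rewrite /finite_norm unlock /Lnorm; apply: poweR_lty.
by under eq_integral do rewrite /= powR_mulrn// real_normK ?num_real//.
Qed.

Lemma L2norm_ge0 f : 0 <= L2norm mu f.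
Proof. exact/fine_ge0/Lnorm_ge0. Qed.

Lemma Lnorm2_sqr f :
  ('N[mu]_2%:E[EFin \o f] ^+ 2 = \int[mu]_t (f t ^+ 2)%:E)%E.
Proof.
have -> : ('N[mu]_2%:E[EFin \o f] ^+ 2 = 'N[mu]_2%:E[EFin \o f] `^ 2)%E.
  case: ('N[mu]_2%:E[EFin \o f])%E (Lnorm_ge0 mu 2%:E (EFin \o f)) => [r r0|_|//].
    by rewrite -EFin_expe poweR_EFin powR_mulrn.
  by rewrite expe2 mulyy poweRyr// pnatr_eq0.
rewrite poweR_Lnorm//.
by under eq_integral do rewrite /= powR_mulrn// real_normK ?num_real//.
Qed.

Lemma L2norm_sqrE f : f \in Lfun mu 2%:E ->
  ((L2norm mu f ^+ 2)%:E = \int[mu]_t (f t ^+ 2)%:E)%E.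
Proof.
move=> /andP[_ /[!inE] ff]; rewrite -Lnorm2_sqr EFin_expe fineK//.
by rewrite ge0_fin_numE//; exact: Lnorm_ge0.
Qed.

Lemma L2norm_sqr f : f \in Lfun mu 2%:E ->
  L2norm mu f ^+ 2 = \int[mu]_t (f t ^+ 2).
Proof. by move=> /L2norm_sqrE fE; rewrite /Rintegral -fE. Qed.

Lemma L2normD f g : f \in Lfun mu 2%:E -> g \in Lfun mu 2%:E ->
  L2norm mu (f \+ g) <= L2norm mu f + L2norm mu g.
Proof.
move=> fL gL; have := ler_LnormD (Lfun_Sub (lee1n 2) fL) (Lfun_Sub (lee1n 2) gL).
by [].
Qed.

Lemma L2normZ (a : R) f : f \in Lfun mu 2%:E ->
  L2norm mu (fun t => a * f t) = `|a| * L2norm mu f.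
Proof.
move=> fL; apply/eqP; rewrite -(@eqrXn2 _ 2) ?mulr_ge0 ?L2norm_ge0//.
rewrite exprMn !L2norm_sqr//; last exact: Lfun2Z.
rewrite -RintegralZl//; last exact: Lfun2_integrable_sqr.
by apply/eqP; apply: eq_Rintegral => t _; rewrite exprMn real_normK ?num_real.
Qed.

Lemma integrableM_L2 f g : f \in Lfun mu 2%:E -> g \in Lfun mu 2%:E ->
  mu.-integrable setT (EFin \o (fun t => f t * g t)).
Proof. by move=> fL gL; apply/Lfun1_integrable/Lfun2_mul_Lfun1. Qed.

End L2_seminorm.

(** * Integrals along a map with a given image measure *)

Section change_of_variables.
Context {R : realType} {d1 d2 : measure_display}.
Context {S1 : measurableType d1} {S2 : measurableType d2}.
Variables (m1 : {measure set S1 -> \bar R}) (m2 : {measure set S2 -> \bar R}).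
Variable (phi : S1 -> S2).
Hypothesis mphi : measurable_fun setT phi.
Hypothesis m2E : forall B, measurable B -> m2 B = m1 (phi @^-1` B).

Lemma ge0_integral_image (f : S2 -> \bar R) : measurable_fun setT f ->
  (forall s, (0 <= f s)%E) -> (\int[m2]_s f s = \int[m1]_s f (phi s))%E.
Proof.
move=> mf f0.
rewrite -(ge0_integral_pushforward mphi m1 measurableT)//.
by apply: eq_measure_integral => B mB _; rewrite /= /pushforward m2E.
Qed.

Lemma integrable_image (f : S2 -> R) : m2.-integrable setT (EFin \o f) ->
  m1.-integrable setT (EFin \o (fun s => f (phi s))).
Proof.
move=> /integrableP[mf foo]; apply/integrableP; split.
  exact: (measurableT_comp mf mphi).
rewrite -(@ge0_integral_image (fun s => `|(f s)%:E|%E))//.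
exact: measurableT_comp.
Qed.

Lemma Rintegral_image (f : S2 -> R) : m2.-integrable setT (EFin \o f) ->
  \int[m1]_s f (phi s) = \int[m2]_s f s.
Proof.
move=> if2; rewrite /Rintegral; congr fine.
rewrite -(integral_pushforward mphi (measurable_int _ if2) _ measurableT)/=; last first.
  exact: integrable_image.
by apply: eq_measure_integral => B mB _; rewrite /= /pushforward m2E.
Qed.

Lemma Lfun2_image (f : S2 -> R) : f \in Lfun m2 2%:E ->
  (fun s => f (phi s)) \in Lfun m1 2%:E.
Proof.
move=> fL; have mf := Lfun2_measurable fL; apply: Lfun2P.
  exact: measurableT_comp.
rewrite -(@ge0_integral_image (fun s => (f s ^+ 2)%:E)).
- by rewrite -L2norm_sqrE// ltry.
- by apply/measurable_EFinP; exact: measurable_funX.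
- by move=> s; rewrite lee_fin sqr_ge0.
Qed.

End change_of_variables.

(** * Conditional expectations integrate bounded multipliers *)

(** The sum counts the k < n+1 with (k+1)/(n+1) <= x, that is, the integer part
    of (n+1) x: a multiplier with values in [0, 1] is a uniform limit of averages
    of indicators of its superlevel sets. *)
Lemma staircase_approx {R : realType} (x : R) (n : nat) : 0 <= x <= 1 ->
  `|x - n.+1%:R^-1 * \sum_(k < n.+1) (k.+1%:R <= n.+1%:R * x)%R%:R| <= n.+1%:R^-1.
Proof.
move=> /andP[x0 x1]; set N := n.+1.
have N0 : 0 < N%:R :> R by rewrite ltr0n.
set m := Num.truncn (N%:R * x).
have Nx0 : 0 <= N%:R * x by rewrite mulr_ge0// ltW.
have mN : (m <= N)%N.
  rewrite -(@ler_nat R) (@le_trans _ _ (N%:R * x))//.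
    by rewrite truncn_le.
  by rewrite ler_piMr// ltW.
have -> : \sum_(k < N) (k.+1%:R <= N%:R * x)%R%:R = m%:R :> R.
  under eq_bigr do rewrite -truncn_gt_nat -/m.
  rewrite -natr_sum; congr _%:R.
  transitivity (\sum_(k < N | (k < m)%N) 1)%N.
    by rewrite [RHS]big_mkcond.
  by rewrite -(big_ord_widen N (fun=> 1%N) mN) sum1_card card_ord.
have /andP[mlo mhi] := truncn_itv Nx0; rewrite -/m in mlo mhi.
rewrite -(ler_pM2l N0) -[X in X * `|_|](ger0_norm (ltW N0)) -normrM.
rewrite mulrBr mulrA !divff ?gt_eqF// mul1r ger0_norm ?subr_ge0//.
by rewrite lerBlDl natr1 ltW.
Qed.

Section real_integrals.
Context {R : realType} {d : measure_display} {S : measurableType d}.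
Variable m : {measure set S -> \bar R}.
Implicit Types f g h : S -> R.

Lemma integrable_measurable f : m.-integrable setT (EFin \o f) ->
  measurable_fun setT f.
Proof. by move=> /measurable_int /measurable_EFinP. Qed.

Lemma integrableM_bounded (C : R) h g : measurable_fun setT h ->
  (forall s, `|h s| <= C) -> m.-integrable setT (EFin \o g) ->
  m.-integrable setT (EFin \o (fun s => h s * g s)).
Proof.
move=> mh hC ig.
apply: (@le_integrable _ _ _ m setT measurableT _ (fun s => C%:E * (g s)%:E)%E).
- apply/measurable_EFinP; apply: measurable_funM => //.
  exact: integrable_measurable.
- move=> s _; rewrite /= lee_fin !normrM ler_wpM2r//.
  by rewrite (le_trans (hC s))// ler_norm.
- exact: integrableZl.
Qed.

Lemma integrable_sumR (J : Type) (s : seq J) (f : J -> S -> R) :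
  (forall j, m.-integrable setT (EFin \o f j)) ->
  m.-integrable setT (EFin \o (fun x => \sum_(j <- s) f j x)).
Proof.
move=> fi; apply: (eq_integrable measurableT (fun x => \sum_(j <- s) (f j x)%:E)%E).
  by move=> x _; rewrite /= sumEFin.
by apply: integrable_sum => // j _; exact: fi.
Qed.

Lemma Rintegral_sum (J : Type) (s : seq J) (f : J -> S -> R) :
  (forall j, m.-integrable setT (EFin \o f j)) ->
  \int[m]_x (\sum_(j <- s) f j x) = \sum_(j <- s) \int[m]_x f j x.
Proof.
move=> fi; elim: s => [|j s ih].
  under eq_Rintegral do rewrite big_nil.
  by rewrite big_nil Rintegral_cst// mul0r.
under eq_Rintegral do rewrite big_cons.
by rewrite RintegralD ?ih ?big_cons//; exact: integrable_sumR.
Qed.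

Lemma Rintegral_multiplier_close (c C D : R) (u v g : S -> R) :
  measurable_fun setT u -> measurable_fun setT v ->
  (forall s, `|u s| <= C) -> (forall s, `|v s| <= D) ->
  (forall s, `|u s - v s| <= c) -> m.-integrable setT (EFin \o g) ->
  `|\int[m]_s (u s * g s) - \int[m]_s (v s * g s)| <= c * \int[m]_s `|g s|.
Proof.
move=> mu mv uC vD uv ig.
have iu := integrableM_bounded mu uC ig; have iv := integrableM_bounded mv vD ig.
have iuv : m.-integrable setT (EFin \o (fun s => u s * g s - v s * g s)).
  exact: (integrableB measurableT iu iv).
rewrite -RintegralB// (le_trans (le_normr_Rintegral _ _))//.
rewrite -RintegralZl//; last exact: integrable_norm.
apply: le_Rintegral => //.
- exact: integrable_norm.
- exact: (integrableZl measurableT c (integrable_norm ig)).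
- by move=> s _; rewrite -mulrBl normrM ler_wpM2r.
Qed.

End real_integrals.

Section conditional_expectation.
Context {R : realType} {dX : measure_display} {X : measurableType dX}.
Variables (rho : probability (X * measurableTypeR R)%type R) (nu : probability X R).

Lemma cond_exp_indic (Zf : X * R -> R) (g : X -> R) (B : set X) :
  is_cond_exp rho nu Zf g -> measurable B ->
  \int[rho]_p (\1_B p.1 * Zf p) = \int[nu]_x (\1_B x * g x).
Proof.
move=> [_ _ ce] mB; have := ce B mB.
rewrite Rintegral_mkcond [in X in _ = X -> _]Rintegral_mkcond => h.
transitivity (\int[rho]_p ((Zf \_ (fst @^-1` B)) p)).
  apply: eq_Rintegral => p _; rewrite /patch indicE.
  have -> : (p \in fst @^-1` B) = (p.1 \in B) by apply/idP/idP; rewrite !inE.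
  by case: ifP => _; rewrite ?mul1r ?mul0r.
rewrite h; apply: eq_Rintegral => x _; rewrite /patch indicE.
by case: ifP => _; rewrite ?mul1r ?mul0r.
Qed.

(** The defining identity on cylinders passes to averages of indicators, and
    [staircase_approx] makes the error at most 1/(n+1) times an integral
    that does not depend on n. *)
Lemma cond_exp_unit (Zf : X * R -> R) (g h : X -> R) :
  is_cond_exp rho nu Zf g -> measurable_fun setT h ->
  (forall x, 0 <= h x <= 1) ->
  \int[rho]_p (h p.1 * Zf p) = \int[nu]_x (h x * g x).
Proof.
move=> ce mh h01; have [iZ ig _] := ce.
pose B n k := [set x | k.+1%:R <= n.+1%:R * h x] : set X.
pose hn n x := n.+1%:R^-1 * \sum_(k < n.+1) \1_(B n k) x : R.
have mB n k : measurable (B n k).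
  rewrite /B -[X in measurable X]setTI.
  by apply: measurable_fun_le => //; exact: measurable_funM.
have mhn n : measurable_fun setT (hn n).
  by apply: measurable_funM => //; apply: measurable_sum => k; exact: measurable_indic.
have hnh n x : `|h x - hn n x| <= n.+1%:R^-1.
  rewrite /hn (eq_bigr (fun k : 'I_n.+1 => (k.+1%:R <= n.+1%:R * h x)%R%:R)).
    exact: staircase_approx.
  by move=> k _; rewrite indicE; congr (_%:R); congr nat_of_bool; apply/idP/idP; rewrite inE.
have h1 x : `|h x| <= 1 by have /andP[? ?] := h01 x; rewrite ger0_norm.
have hn2 n x : `|hn n x| <= 2.
  rewrite (_ : hn n x = h x - (h x - hn n x)); last by ring.
  rewrite (le_trans (ler_normB _ _))// -[leRHS]/(1 + 1) lerD//.
  by rewrite (le_trans (hnh _ _))// invf_le1 ?ler1n.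
have step n : \int[rho]_p (hn n p.1 * Zf p) = \int[nu]_x (hn n x * g x).
  have i1 k : rho.-integrable setT (EFin \o (fun p => \1_(B n k) p.1 * Zf p)).
    apply: (@integrableM_bounded _ _ _ _ 1) => //.
      exact: (measurableT_comp (measurable_indic (mB n k)) measurable_fst).
    by move=> p; rewrite indicE normr_nat; case: (_ \in _).
  have i2 k : nu.-integrable setT (EFin \o (fun x => \1_(B n k) x * g x)).
    apply: (@integrableM_bounded _ _ _ _ 1) => //.
    by move=> p; rewrite indicE normr_nat; case: (_ \in _).
  rewrite /hn.
  under eq_Rintegral do rewrite -mulrA mulr_suml.
  rewrite RintegralZl//; last exact: integrable_sumR.
  rewrite Rintegral_sum//.
  under [RHS]eq_Rintegral do rewrite -mulrA mulr_suml.
  rewrite RintegralZl//; last exact: integrable_sumR.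
  rewrite Rintegral_sum//; congr (_ * _); apply: eq_bigr => k _.
  exact: cond_exp_indic.
set K := \int[rho]_p `|Zf p| + \int[nu]_x `|g x|.
apply/eqP; rewrite -subr_eq0 -normr_le0; apply/ler_addgt0Pr => e e0; rewrite add0r.
have K0 : 0 <= K by rewrite addr_ge0// Rintegral_ge0.
pose n := Num.truncn (K / e).
have nK : n.+1%:R^-1 * K <= e.
  rewrite mulrC ler_pdivrMr// mulrC -ler_pdivrMr//.
  by rewrite ltW// truncnS_gt.
apply: le_trans nK; rewrite mulrDr.
rewrite (_ : _ - _ = (\int[rho]_p (h p.1 * Zf p) - \int[rho]_p (hn n p.1 * Zf p))
   - (\int[nu]_x (h x * g x) - \int[nu]_x (hn n x * g x))); last first.
  by rewrite step; ring.
rewrite (le_trans (ler_normB _ _))// lerD//.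
  apply: (@Rintegral_multiplier_close _ _ _ _ _ 1 2 (fun p => h p.1) (fun p => hn n p.1)) => //.
  - exact: measurableT_comp.
  - exact: (measurableT_comp (mhn n)).
exact: (@Rintegral_multiplier_close _ _ _ _ _ 1 2).
Qed.

(** An affine change of variable brings the multiplier into [0, 1]. *)
Lemma cond_exp_bounded (C : R) (Zf : X * R -> R) (g h : X -> R) :
  is_cond_exp rho nu Zf g -> measurable_fun setT h ->
  (forall x, `|h x| <= C) ->
  \int[rho]_p (h p.1 * Zf p) = \int[nu]_x (h x * g x).
Proof.
move=> ce mh hC; have [iZ ig _] := ce.
pose D := `|C| + 1; have D0 : 0 < D by rewrite ltr_pwDr.
have hD x : `|h x| <= D.
  by rewrite (le_trans (hC x))// (le_trans (ler_norm _))// lerDl.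
pose k x := (2 * D)^-1 * (h x + D).
have mk : measurable_fun setT k.
  by apply: measurable_funM => //; exact: measurable_funD.
have k01 x : 0 <= k x <= 1.
  have := hD x; rewrite ler_norml => /andP[h1 h2]; apply/andP; split.
    by apply: mulr_ge0; [rewrite invr_ge0|]; lra.
  by rewrite ler_pdivrMl ?mulr_gt0// mulr1 mulrDl mul1r lerD2r.
have k1 x : `|k x| <= 1 by have /andP[? ?] := k01 x; rewrite ger0_norm.
have hk x : h x = 2 * D * k x - D.
  by rewrite /k mulrA divff ?mul1r ?addrK// mulf_neq0 ?gt_eqF.
have ce1 := cond_exp_unit ce mk k01.
have ce2 : \int[rho]_p (1 * Zf p) = \int[nu]_x (1 * g x).
  by apply: (@cond_exp_unit Zf g (fun=> 1) ce) => // x; rewrite ler01 lexx.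
have i1 : rho.-integrable setT (EFin \o (fun p => k p.1 * Zf p)).
  by apply: (@integrableM_bounded _ _ _ _ 1) => //; exact: measurableT_comp.
have i2 : nu.-integrable setT (EFin \o (fun x => k x * g x)).
  by apply: (@integrableM_bounded _ _ _ _ 1).
have i3 : rho.-integrable setT (EFin \o (fun p => 1 * Zf p)).
  by under eq_fun do rewrite mul1r.
have i4 : nu.-integrable setT (EFin \o (fun x => 1 * g x)).
  by under eq_fun do rewrite mul1r.
transitivity (\int[rho]_p (2 * D * (k p.1 * Zf p) - D * (1 * Zf p))).
  by apply: eq_Rintegral => p _; rewrite hk; ring.
transitivity (\int[nu]_x (2 * D * (k x * g x) - D * (1 * g x))); last first.
  by apply: eq_Rintegral => x _; rewrite hk; ring.
rewrite RintegralB//; [|exact: (integrableZl measurableT (2 * D) i1)|exact: (integrableZl measurableT D i3)].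
rewrite RintegralB//; [|exact: (integrableZl measurableT (2 * D) i2)|exact: (integrableZl measurableT D i4)].
rewrite (RintegralZl _ _ i1)// (RintegralZl _ _ i2)//.
by rewrite (RintegralZl _ _ i3)// (RintegralZl _ _ i4)// ce1 ce2.
Qed.

End conditional_expectation.

(** * Moments of an i.i.d. sample *)

Section samples.
Context {R : realType} {dX dO : measure_display}.
Context {X : measurableType dX} {Om : measurableType dO}.
Variables (rho : probability (X * measurableTypeR R)%type R).
Variables (P : probability Om R).
Variable (Z : nat -> {RV P >-> (X * measurableTypeR R)%type}).
Hypothesis hZ : iid_sample rho Z.
Local Notation S := (X * measurableTypeR R)%type.

Lemma measurable_sample i : measurable_fun setT (Z i : Om -> S).
Proof. exact: measurable_funPT. Qed.

Lemma iid_pair i j (A B : set S) : i != j -> measurable A -> measurable B ->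
  P (Z i @^-1` A `&` Z j @^-1` B) = (rho A * rho B)%E.
Proof.
move=> ij mA mB.
pose D k := if k == i then A else if k == j then B else setT.
have mD k : measurable (D k) by rewrite /D; case: ifP => // _; case: ifP.
set n := (maxn i j).+1.
have iN : (i < n)%N by rewrite ltnS leq_maxl.
have jN : (j < n)%N by rewrite ltnS leq_maxr.
have Di : D i = A by rewrite /D eqxx.
have Dj : D j = B by rewrite /D eqxx eq_sym (negbTE ij).
transitivity (P (\bigcap_(k < n) (Z k @^-1` D k))).
  congr (P _); apply/seteqP; split => w /=.
    move=> [wA wB] k _ /=; rewrite /D; case: eqP => [->//|_].
    by case: eqP => [->|].
  by move=> wD; split; [have := wD i iN; rewrite /= Di|have := wD j jN; rewrite /= Dj].
rewrite (iid_indep hZ _ mD) (bigD1 (Ordinal iN))//= (bigD1 (Ordinal jN))/=; last first.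
  by rewrite eq_sym.
rewrite big1 ?mule1 ?Di ?Dj ?(iid_law hZ)// => k /andP[ki kj].
rewrite /D; case: eqP => [ki'|_]; first by rewrite -val_eqE /= ki' eqxx in ki.
case: eqP => [kj'|_]; first by rewrite -val_eqE /= kj' eqxx in kj.
by rewrite preimage_setT probability_setT.
Qed.

Lemma measurable_sample_pair i j :
  measurable_fun setT (fun w => (Z i w, Z j w) : S * S).
Proof. by apply: measurable_fun_pair; exact: measurable_sample. Qed.

(** The two laws agree on rectangles, which determine a product measure. *)
Lemma iid_pair_law i j (C : set (S * S)) : i != j -> measurable C ->
  (rho \x rho)%E C = P ((fun w => (Z i w, Z j w)) @^-1` C).
Proof.
move=> ij mC.
pose phi w : S * S := (Z i w, Z j w).
pose mphi := measurable_sample_pair i j.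
pose mm := isMeasurableFun.Build _ _ _ _ _ mphi.
pose F : {mfun Om >-> (S * S)%type} := HB.pack phi mm.
have h := @product_measure_unique _ _ _ _ R rho rho (pushforward P F).
by rewrite h// => A B mA mB; rewrite /pushforward /= -(iid_pair ij).
Qed.

Lemma integrable_sample (f : S -> R) i : rho.-integrable setT (EFin \o f) ->
  P.-integrable setT (EFin \o (fun w => f (Z i w))).
Proof.
apply: integrable_image; first exact: measurable_sample.
by move=> B mB; symmetry; exact: (iid_law hZ i mB).
Qed.

Lemma expectation_sample (f : S -> R) i : rho.-integrable setT (EFin \o f) ->
  \int[P]_w f (Z i w) = \int[rho]_p f p.
Proof.
apply: Rintegral_image; first exact: measurable_sample.
by move=> B mB; symmetry; exact: (iid_law hZ i mB).
Qed.

Lemma integrable_tensor (f g : S -> R) :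
  rho.-integrable setT (EFin \o f) -> rho.-integrable setT (EFin \o g) ->
  (rho \x rho)%E.-integrable setT (EFin \o (fun q => f q.1 * g q.2)).
Proof.
move=> fi gi.
have mf := integrable_measurable fi; have mg := integrable_measurable gi.
apply/integrable12ltyP.
  apply/measurable_EFinP; apply: measurable_funM; exact: measurableT_comp.
rewrite (_ : \int[_]_x _ = (\int[rho]_x `|f x|%:E) * (\int[rho]_x `|g x|%:E))%E.
  rewrite lte_mul_pinfty//.
  - exact: integral_ge0.
  - by apply: integrable_fin_num => //; exact: integrable_norm.
  - by apply: integrable_lty => //; exact: integrable_norm.
rewrite -ge0_integralZr//.
- apply: eq_integral => x _; rewrite -ge0_integralZl//.
    by apply: eq_integral => x' _; rewrite /= normrM EFinM.
  by apply/measurable_EFinP; exact: measurableT_comp.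
- by apply/measurable_EFinP; exact: measurableT_comp.
- exact: integral_ge0.
Qed.

Lemma Rintegral_tensor (f g : S -> R) :
  rho.-integrable setT (EFin \o f) -> rho.-integrable setT (EFin \o g) ->
  \int[(rho \x rho)%E]_q (f q.1 * g q.2) = \int[rho]_p f p * \int[rho]_p g p.
Proof.
move=> fi gi; have fgi := integrable_tensor fi gi.
rewrite /Rintegral -(integral12_prod_meas1 fgi).
rewrite -fineM; [|exact: integrable_fin_num..].
congr fine; rewrite -[X in (_ * X)%E]fineK; last exact: integrable_fin_num.
rewrite -integralZr//; apply: eq_integral => x _.
rewrite fineK; last exact: integrable_fin_num.
by rewrite /fubini_F /= -integralZl//; apply: eq_integral.
Qed.

Lemma integrable_sampleM (f g : S -> R) i j : i != j ->
  rho.-integrable setT (EFin \o f) -> rho.-integrable setT (EFin \o g) ->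
  P.-integrable setT (EFin \o (fun w => f (Z i w) * g (Z j w))).
Proof.
move=> ij fi gi; have fgi := integrable_tensor fi gi.
apply: (integrable_image (measurable_sample_pair i j) _ fgi) => C mC.
exact: iid_pair_law.
Qed.

Lemma expectation_sampleM (f g : S -> R) i j : i != j ->
  rho.-integrable setT (EFin \o f) -> rho.-integrable setT (EFin \o g) ->
  \int[P]_w (f (Z i w) * g (Z j w)) = \int[rho]_p f p * \int[rho]_p g p.
Proof.
move=> ij fi gi; have fgi := integrable_tensor fi gi; rewrite -Rintegral_tensor//.
apply: (Rintegral_image (measurable_sample_pair i j) _ fgi) => C mC.
exact: iid_pair_law.
Qed.

End samples.

(** * A lower bound for the second moment of a sample mean *)

Lemma Rintegral_le_ge0 {R : realType} d (S : measurableType d)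
  (m : {measure set S -> \bar R}) (l u : S -> R) :
  m.-integrable setT (EFin \o l) -> measurable_fun setT u ->
  (forall s, 0 <= u s) -> (forall s, l s <= u s) ->
  ((\int[m]_s l s)%:E <= \int[m]_s (u s)%:E)%E.
Proof.
move=> il mu u0 lu; rewrite /Rintegral fineK; last exact: integrable_fin_num.
have ilp := integrable_funepos measurableT il.
apply: (@le_trans _ _ (\int[m]_s ((EFin \o l)^\+ s))%E).
  apply: le_integral => // s _.
  by rewrite funeposE le_max lexx.
apply: ge0_le_integral => //.
- exact: measurable_int ilp.
- exact/measurable_EFinP.
- by move=> s _; rewrite funeposE ge_max !lee_fin lu u0.
Qed.

Section second_moment.
Context {R : realType} {dX dO : measure_display}.
Context {X : measurableType dX} {Om : measurableType dO}.
Variables (rho : probability (X * measurableTypeR R)%type R).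
Variables (P : probability Om R).
Variable (Z : nat -> {RV P >-> (X * measurableTypeR R)%type}).
Hypothesis hZ : iid_sample rho Z.
Variable n : nat.
Hypothesis n_gt0 : (0 < n)%N.
Local Notation S := (X * measurableTypeR R)%type.
Implicit Types f g xi eta : S -> R.

Definition sample_mean f (w : Om) : R := n%:R^-1 * \sum_(i < n) f (Z i w).

Let n_neq0 : n%:R != 0 :> R. Proof. by rewrite pnatr_eq0 -lt0n. Qed.

Lemma integrable_sample_mean f : rho.-integrable setT (EFin \o f) ->
  P.-integrable setT (EFin \o sample_mean f).
Proof.
move=> fi.
apply: (integrableZl measurableT n%:R^-1 (f := fun w => (\sum_(i < n) f (Z i w))%:E)) => //.
apply: (integrable_sumR _ (f := fun (i : 'I_n) w => f (Z i w))) => i.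
exact: (integrable_sample hZ).
Qed.

Lemma expectation_sample_mean f : rho.-integrable setT (EFin \o f) ->
  \int[P]_w sample_mean f w = \int[rho]_p f p.
Proof.
move=> fi; have fZi (i : 'I_n) := integrable_sample hZ i fi.
rewrite /sample_mean RintegralZl//; last exact: integrable_sumR.
rewrite Rintegral_sum//.
under eq_bigr do rewrite (expectation_sample hZ _ fi).
by rewrite sumr_const card_ord -(mulr_natl (\int[rho]_p f p)) mulrA mulVf// mul1r.
Qed.

Lemma sample_meanM f g w : sample_mean f w * sample_mean g w =
  n%:R^-1 * (n%:R^-1 * \sum_(i < n) \sum_(j < n) f (Z i w) * g (Z j w)).
Proof.
by rewrite /sample_mean mulrACA -mulrA; congr (_ * (_ * _)); rewrite big_distrlr.
Qed.

(** The diagonal terms need the product f g to be integrable; the others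
    follow from independence. *)
Lemma integrable_sample_pair f g (i j : 'I_n) :
  rho.-integrable setT (EFin \o f) -> rho.-integrable setT (EFin \o g) ->
  rho.-integrable setT (EFin \o (fun p => f p * g p)) ->
  P.-integrable setT (EFin \o (fun w => f (Z i w) * g (Z j w))).
Proof.
move=> fi gi fgi; have [<-|ij] := eqVneq i j.
  exact: (integrable_sample hZ i fgi).
exact: (integrable_sampleM hZ).
Qed.

Lemma integrable_sample_meanM f g :
  rho.-integrable setT (EFin \o f) -> rho.-integrable setT (EFin \o g) ->
  rho.-integrable setT (EFin \o (fun p => f p * g p)) ->
  P.-integrable setT (EFin \o (fun w => sample_mean f w * sample_mean g w)).
Proof.
move=> fi gi fgi; under eq_fun do rewrite sample_meanM.
pose h w := \sum_(i < n) \sum_(j < n) f (Z i w) * g (Z j w).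
have ih : P.-integrable setT (EFin \o h).
  apply: integrable_sumR => i; apply: integrable_sumR => j.
  exact: integrable_sample_pair.
exact: (integrableZl measurableT _ (integrableZl measurableT _ ih)).
Qed.

Lemma expectation_sample_meanM f g :
  rho.-integrable setT (EFin \o f) -> rho.-integrable setT (EFin \o g) ->
  rho.-integrable setT (EFin \o (fun p => f p * g p)) ->
  \int[rho]_p g p = 0 ->
  \int[P]_w (sample_mean f w * sample_mean g w) =
  n%:R^-1 * \int[rho]_p (f p * g p).
Proof.
move=> fi gi fgi g0; under eq_Rintegral do rewrite sample_meanM.
have ij i j := integrable_sample_pair i j fi gi fgi.
have ii (i : 'I_n) : P.-integrable setT
    (EFin \o (fun w => \sum_(j < n) f (Z i w) * g (Z j w))).
  exact: integrable_sumR.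
have ih := integrable_sumR (index_enum 'I_n) ii.
rewrite RintegralZl//; last exact: (integrableZl measurableT _ ih).
rewrite (RintegralZl _ _ ih)// Rintegral_sum//.
under eq_bigr => i _.
  rewrite Rintegral_sum// (bigD1 i)//= (expectation_sample hZ i fgi) big1; last first.
    move=> j ji; rewrite (expectation_sampleM hZ _ fi gi) ?g0 ?mulr0//.
    by rewrite eq_sym.
  rewrite addr0; over.
rewrite sumr_const card_ord -(mulr_natl (\int[rho]_p (f p * g p))).
by rewrite (mulrA n%:R^-1 n%:R) mulVf// mul1r.
Qed.

(** With W = sample_mean xi - c, b = E W and the test variable
    V = b + sample_mean eta, the inequality W^2 >= 2 W V - V^2 holds pointwise.
    Independence and E eta = 0 give E[W V] = E[V^2] = b^2 + E[eta^2] / n, hence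
    the claim.  Only W V has to be integrable, so xi itself may have an infinite
    second moment. *)
Lemma second_moment_ge xi eta c :
  rho.-integrable setT (EFin \o xi) -> rho.-integrable setT (EFin \o eta) ->
  rho.-integrable setT (EFin \o (fun p => xi p * eta p)) ->
  rho.-integrable setT (EFin \o (fun p => eta p * eta p)) ->
  \int[rho]_p eta p = 0 ->
  \int[rho]_p (xi p * eta p) = \int[rho]_p (eta p * eta p) ->
  (((\int[rho]_p xi p - c) ^+ 2 + n%:R^-1 * \int[rho]_p (eta p * eta p))%:E <=
   \int[P]_w ((sample_mean xi w - c) ^+ 2)%:E)%E.
Proof.
move=> xii etai xietai eta2i eta0 xietaE.
set s := \int[rho]_p (eta p * eta p); set b := \int[rho]_p xi p - c.
have A1 := integrable_sample_mean xii.
have A2 := integrable_sample_mean etai.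
have A3 := integrable_sample_meanM xii etai xietai.
have A4 := integrable_sample_meanM etai etai eta2i.
pose l1 w := 2 * b * sample_mean xi w.
pose l2 w := 2 * (sample_mean xi w * sample_mean eta w).
pose l3 w := 2 * (c + b) * sample_mean eta w.
pose l4 w := sample_mean eta w * sample_mean eta w.
pose k := 2 * b * c + b ^+ 2.
have B1 : P.-integrable setT (EFin \o l1) := integrableZl measurableT _ A1.
have B2 : P.-integrable setT (EFin \o l2) := integrableZl measurableT _ A3.
have B3 : P.-integrable setT (EFin \o l3) := integrableZl measurableT _ A2.
have B5 : P.-integrable setT (EFin \o (fun=> k)).
  exact: finite_measure_integrable_cst.
have C1 : P.-integrable setT (EFin \o (fun w => l1 w + l2 w)).
  exact: (integrableD measurableT B1 B2).
have C2 : P.-integrable setT (EFin \o (fun w => l1 w + l2 w - l3 w)).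
  exact: (integrableB measurableT C1 B3).
have C3 : P.-integrable setT (EFin \o (fun w => l1 w + l2 w - l3 w - l4 w)).
  exact: (integrableB measurableT C2 A4).
pose l w := l1 w + l2 w - l3 w - l4 w - k.
have il : P.-integrable setT (EFin \o l).
  exact: (integrableB measurableT C3 B5).
have -> : b ^+ 2 + n%:R^-1 * s = \int[P]_w l w.
  rewrite /l (RintegralB _ C3 B5)// (RintegralB _ C2 A4)// (RintegralB _ C1 B3)//.
  rewrite (RintegralD _ B1 B2)// /l1 /l2 /l3 /l4.
  rewrite (RintegralZl _ _ A1)// (RintegralZl _ _ A2)// (RintegralZl _ _ A3)//.
  have -> : \int[P]_w k = k.
    by rewrite Rintegral_cst// [X in fine X](_ : _ = 1%E) ?mulr1//; exact: probability_setT.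
  rewrite !expectation_sample_mean// !expectation_sample_meanM// eta0 xietaE -/s.
  have -> : \int[rho]_p xi p = b + c by rewrite /b subrK.
  by rewrite /k; ring.
apply: (Rintegral_le_ge0 il) => [|w|w]; last 2 first.
- exact: sqr_ge0.
- rewrite /l /l1 /l2 /l3 /l4 /k -subr_ge0.
  set x := sample_mean xi w; set y := sample_mean eta w.
  by rewrite (_ : _ - _ = (x - c - b - y) ^+ 2) ?sqr_ge0//; ring.
apply: measurable_funX; apply: measurable_funB => //.
exact: integrable_measurable A1.
Qed.

End second_moment.

(** * The regression model *)

Section truncation.
Context {R : realType} {d : measure_display} {S : measurableType d}.
Variable m : {measure set S -> \bar R}.

Lemma cvg_Rintegral_dominated (f_ : nat -> S -> R) (f g : S -> R) :
  (forall n, measurable_fun setT (f_ n)) ->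
  (forall s, f_ n s @[n --> \oo] --> f s) ->
  m.-integrable setT (EFin \o g) -> (forall n s, `|f_ n s| <= g s) ->
  \int[m]_s f_ n s @[n --> \oo] --> \int[m]_s f s.
Proof.
move=> mf_ f_f ig f_g.
have mE n : measurable_fun setT (EFin \o f_ n) by exact/measurable_EFinP.
have cE s : setT s -> (EFin \o f_ n) s @[n --> \oo] --> (EFin \o f) s.
  by move=> _; apply/cvg_EFin; [exact: nearW|exact: f_f].
have lE n s : setT s -> (`|(EFin \o f_ n) s| <= (EFin \o g) s)%E.
  by move=> _; rewrite lee_fin.
have mf : measurable_fun setT (EFin \o f).
  exact: (emeasurable_fun_cvg (fun n => EFin \o f_ n) _ mE cE).
have [fi _ _] := dominated_convergence measurableT mE mf
  (aeW _ (fun s _ => cE s I)) ig (aeW _ (fun s n _ => lE n s I)).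
apply: fine_cvg; rewrite [X in _ --> X]fineK; last exact: integrable_fin_num.
exact: (dominated_cvg measurableT mE cE _ ig lE).
Qed.

(** Cutting off along u and v at once: multiplying by this factor makes both
    bounded, and the factor is eventually 1 at each point. *)
Definition truncation (u v : S -> R) (k : nat) (s : S) : R :=
  \1_[set s | `|u s| <= k%:R /\ `|v s| <= k%:R] s.

Lemma measurable_truncation u v k : measurable_fun setT u -> measurable_fun setT v ->
  measurable_fun setT (truncation u v k).
Proof.
move=> mu mv; apply: measurable_indic.
have -> : [set s | `|u s| <= k%:R /\ `|v s| <= k%:R] =
    (setT `&` [set s | `|u s| <= k%:R]) `&` (setT `&` [set s | `|v s| <= k%:R]).
  by rewrite !setTI.
apply: measurableI; apply: measurable_fun_le => //.
  exact: (measurableT_comp (@normr_measurable R setT) mu).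
exact: (measurableT_comp (@normr_measurable R setT) mv).
Qed.

Lemma truncationP u v k s : truncation u v k s = 0 \/
  [/\ truncation u v k s = 1, `|u s| <= k%:R & `|v s| <= k%:R].
Proof.
rewrite /truncation indicE; case E : (_ \in _); last by left.
by move/set_mem : E => -[? ?]; right.
Qed.

Lemma cvg_truncation u v f s : truncation u v k s * f @[k --> \oo] --> (f : R).
Proof.
apply: cvg_near_cst; exists (Num.truncn (Num.max `|u s| `|v s|)).+1 => // k /= hk.
have lek : Num.max `|u s| `|v s| <= k%:R.
  by rewrite (le_trans (ltW (truncnS_gt _)))// ler_nat.
move: lek; rewrite ge_max => /andP[uk vk].
by rewrite /truncation indicE mem_set ?mul1r.
Qed.

End truncation.

(** Dominated convergence along truncations extends [cond_exp_bounded] to all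
    multipliers for which both integrals make sense. *)
Lemma cond_exp_mul {R : realType} dX (X : measurableType dX)
  (rho : probability (X * measurableTypeR R)%type R) (nu : probability X R)
  (Zf : X * R -> R) (g h : X -> R) :
  is_cond_exp rho nu Zf g -> measurable_fun setT h ->
  rho.-integrable setT (EFin \o (fun p => h p.1 * Zf p)) ->
  nu.-integrable setT (EFin \o (fun x => h x * g x)) ->
  \int[rho]_p (h p.1 * Zf p) = \int[nu]_x (h x * g x).
Proof.
move=> ce mh i1 i2.
have mt k : measurable_fun setT (truncation h h k) by exact: measurable_truncation.
pose L k := \int[rho]_p (truncation h h k p.1 * (h p.1 * Zf p)).
have c1 : L k @[k --> \oo] --> \int[rho]_p (h p.1 * Zf p).
  apply: (cvg_Rintegral_dominated _ _ (integrable_norm i1)) => [k|p|k p] /=.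
  - apply: measurable_funM; last exact: integrable_measurable i1.
    exact: (measurableT_comp (mt k)).
  - exact: cvg_truncation.
  - by case: (truncationP h h k p.1) => [->|[-> _ _]]; rewrite ?mul1r// mul0r normr0.
have c2 : L k @[k --> \oo] --> \int[nu]_x (h x * g x).
  rewrite (_ : L = fun k => \int[nu]_x (truncation h h k x * (h x * g x))).
    apply: (cvg_Rintegral_dominated _ _ (integrable_norm i2)) => [k|x|k x] /=.
    - by apply: measurable_funM => //; exact: integrable_measurable i2.
    - exact: cvg_truncation.
    - by case: (truncationP h h k x) => [->|[-> _ _]]; rewrite ?mul1r// mul0r normr0.
  apply/funext => k; rewrite /L.
  under eq_Rintegral do rewrite mulrA.
  under [RHS]eq_Rintegral do rewrite mulrA.
  apply: (@cond_exp_bounded _ _ _ _ _ k%:R _ _ (fun x => truncation h h k x * h x)) => //.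
    exact: measurable_funM.
  move=> x; case: (truncationP h h k x) => [->|[-> hk _]]; rewrite ?mul1r//.
  by rewrite mul0r normr0.
by rewrite -(cvg_lim _ c1)// -(cvg_lim _ c2).
Qed.

Lemma Lfun2_integrable {R : realType} d (S : measurableType d)
  (m : probability S R) (f : S -> R) :
  f \in Lfun m 2%:E -> m.-integrable setT (EFin \o f).
Proof.
move=> fL; have := integrableM_L2 fL (Lfun_cst m 1 2).
by apply: eq_integrable => // p _; rewrite /= mulr1.
Qed.

Section regression.
Context {R : realType} {dX dO : measure_display}.
Context {X : measurableType dX} {Om : measurableType dO}.
Variables (rho : probability (X * measurableTypeR R)%type R) (nu : probability X R).
Hypothesis hnu : is_marginal rho nu.
Variables (y : X -> R) (sigma : R).
Hypothesis hy : y \in Lfun nu 2%:E.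
Hypothesis hrho : regression_model rho nu y sigma.
Local Notation S := (X * measurableTypeR R)%type.

Let my : measurable_fun setT y. Proof. exact: Lfun2_measurable hy. Qed.

Let L2fst (h : X -> R) : h \in Lfun nu 2%:E ->
  (fun p : S => h p.1) \in Lfun rho 2%:E.
Proof. exact: (Lfun2_image measurable_fst). Qed.

Lemma residual_L2 : (fun p : S => p.2 - y p.1) \in Lfun rho 2%:E.
Proof.
have [_ [iv _ _]] := hrho; apply: Lfun2P; last exact: integrable_lty iv.
by apply: measurable_funB; [exact: measurable_snd|exact: (measurableT_comp my)].
Qed.

Lemma response_L2 : (fun p : S => p.2 : R) \in Lfun rho 2%:E.
Proof.
have := Lfun2D residual_L2 (L2fst hy).
by under [X in X \in _]eq_fun do rewrite subrK.
Qed.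

Lemma residual_orthogonal (C : R) (h : X -> R) : measurable_fun setT h ->
  (forall x, `|h x| <= C) -> \int[rho]_p (h p.1 * (p.2 - y p.1)) = 0.
Proof.
move=> mh hC; have [ce _] := hrho.
have mh1 : measurable_fun setT (fun p : S => h p.1) by exact: (measurableT_comp mh).
under eq_Rintegral do rewrite mulrBr.
rewrite RintegralB//.
- rewrite (cond_exp_bounded ce mh hC).
  rewrite (Rintegral_image measurable_fst hnu (f := fun x => h x * y x)) ?subrr//.
  by apply: (integrableM_bounded mh hC); case: ce.
- by apply: (integrableM_bounded mh1) => //; exact: Lfun2_integrable response_L2.
- apply: (integrableM_bounded mh1) => //; apply: Lfun2_integrable; exact: L2fst.
Qed.

Variables (P : probability Om R).
Variable (Z : nat -> {RV P >-> (X * measurableTypeR R)%type}).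
Hypothesis hZ : iid_sample rho Z.

(** [second_moment_ge] for xi = g(X) Y and eta = g_k(X) (Y - y(X)), where g_k is
    g set to 0 where |g| or |y| exceeds k: the moments that involve eta are then
    integrals of bounded multipliers against Y or (Y - y(X))^2, and the
    conditional mean and variance of Y give E[xi eta] = E[eta^2] =
    sigma^2 ||g_k||^2.  The claim follows as k tends to infinity. *)
Lemma sample_mean_risk_ge (n : nat) (g : X -> R) (c : R) : (0 < n)%N ->
  g \in Lfun nu 2%:E ->
  (((\int[nu]_x (g x * y x) - c) ^+ 2 +
    sigma ^+ 2 / n%:R * \int[nu]_x (g x ^+ 2))%:E <=
  \int[P]_w ((sample_mean Z n (fun p => (g p.1 * p.2)%R) w - c) ^+ 2)%:E)%E.
Proof.
move=> n0 hg; have [ce cv] := hrho; have mg := Lfun2_measurable hg.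
set I := (X in (_ <= X)%E).
have Ige0 : (0 <= I)%E by apply: integral_ge0 => w _; rewrite lee_fin sqr_ge0.
have [Ioo|Ioo] := eqVneq I +oo%E; first by rewrite Ioo leey.
have Ifin : I \is a fin_num by rewrite ge0_fin_numE// lt_neqAle Ioo leey.
rewrite -(fineK Ifin) lee_fin.
have iv := Lfun2_integrable residual_L2.
have ixi : rho.-integrable setT (EFin \o (fun p => g p.1 * p.2)).
  exact: (integrableM_L2 (L2fst hg) response_L2).
have igy : nu.-integrable setT (EFin \o (fun x => g x * y x)).
  exact: (integrableM_L2 hg hy).
have xiE : \int[rho]_p (g p.1 * p.2) = \int[nu]_x (g x * y x).
  exact: (cond_exp_mul ce mg ixi igy).
pose gt k x := truncation g y k x * g x.
have mgt k : measurable_fun setT (gt k).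
  by apply: measurable_funM => //; exact: measurable_truncation.
have gtb k x : `|gt k x| <= k%:R.
  rewrite /gt; case: (truncationP g y k x) => [->|[-> ? _]]; rewrite ?mul1r//.
  by rewrite mul0r normr0.
have gt2b k x : `|gt k x ^+ 2| <= k%:R ^+ 2.
  by rewrite normrX lerXn2r ?nnegrE.
have step k : (\int[nu]_x (g x * y x) - c) ^+ 2 +
    sigma ^+ 2 / n%:R * \int[nu]_x (gt k x ^+ 2) <= fine I.
  pose eta (p : S) := gt k p.1 * (p.2 - y p.1).
  have mgt1 : measurable_fun setT (fun p : S => gt k p.1).
    exact: (measurableT_comp (mgt k)).
  have mgt2 : measurable_fun setT (fun p : S => gt k p.1 ^+ 2).
    exact: measurable_funX.
  have ieta : rho.-integrable setT (EFin \o eta).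
    by apply: (integrableM_bounded mgt1) => //.
  have ieta2 : rho.-integrable setT (EFin \o (fun p => eta p * eta p)).
    have := integrableM_bounded mgt2 (fun p => gt2b k p.1)
      (integrableM_L2 residual_L2 residual_L2).
    by apply: eq_integrable => // p _; rewrite /= /eta; congr EFin; ring.
  have xietaE p : g p.1 * p.2 * eta p = gt k p.1 ^+ 2 * (p.2 * (p.2 - y p.1)).
    by rewrite /eta /gt; case: (truncationP g y k p.1) => [->|[-> _ _]]; ring.
  have ixieta : rho.-integrable setT (EFin \o (fun p => g p.1 * p.2 * eta p)).
    under eq_fun do rewrite xietaE.
    exact: (integrableM_bounded mgt2 (fun p => gt2b k p.1)
      (integrableM_L2 response_L2 residual_L2)).
  have eta0 : \int[rho]_p eta p = 0 by exact: (residual_orthogonal (mgt k) (gtb k)).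
  have eta2 : \int[rho]_p (eta p * eta p) = sigma ^+ 2 * \int[nu]_x (gt k x ^+ 2).
    transitivity (\int[rho]_p (gt k p.1 ^+ 2 * (p.2 - y p.1) ^+ 2)).
      by apply: eq_Rintegral => p _; rewrite /eta; ring.
    rewrite (cond_exp_bounded cv (measurable_funX 2 (mgt k)) (gt2b k)).
    under eq_Rintegral do rewrite mulrC.
    rewrite RintegralZl//; apply: measurable_bounded_integrable => //.
    - by rewrite (@le_lt_trans _ _ 1%E) ?ltry// probability_le1.
    - exact: measurable_funX.
    - exists (k%:R ^+ 2); split=> [|r kr x _]; first exact: num_real.
      exact: le_trans (gt2b k x) (ltW kr).
  have xieta : \int[rho]_p (g p.1 * p.2 * eta p) = \int[rho]_p (eta p * eta p).
    have mk : measurable_fun setT (fun x => gt k x ^+ 2 * y x).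
      by apply: measurable_funM => //; exact: measurable_funX.
    have bk x : `|gt k x ^+ 2 * y x| <= k%:R ^+ 3.
      rewrite /gt; case: (truncationP g y k x) => [->|[-> gk yk]].
        by rewrite mul0r expr0n mul0r normr0 exprn_ge0.
      by rewrite mul1r normrM normrX [k%:R ^+ 3]exprSr ler_pM ?exprn_ge0 ?lerXn2r ?nnegrE.
    have := residual_orthogonal mk bk => orth.
    have imk : rho.-integrable setT (EFin \o
        (fun p => gt k p.1 ^+ 2 * y p.1 * (p.2 - y p.1))).
      apply: (integrableM_bounded _ (fun p => bk p.1)) => //.
      exact: (measurableT_comp mk).
    transitivity (\int[rho]_p (eta p * eta p + gt k p.1 ^+ 2 * y p.1 * (p.2 - y p.1))).
      by apply: eq_Rintegral => p _; rewrite xietaE /eta; ring.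
    by rewrite RintegralD// orth addr0.
  have := second_moment_ge hZ n0 c ixi ieta ixieta ieta2 eta0 xieta.
  rewrite -/I -(fineK Ifin) lee_fin xiE eta2; apply: le_trans.
  by rewrite lerD2l mulrA mulrC [sigma ^+ 2 / _]mulrC mulrC.
have cg : \int[nu]_x (gt k x ^+ 2) @[k --> \oo] --> \int[nu]_x (g x ^+ 2).
  apply: (cvg_Rintegral_dominated _ _ (Lfun2_integrable_sqr hg)) => [k|x|k x].
  - exact: measurable_funX.
  - rewrite (_ : (fun k => gt k x ^+ 2) = (fun k => truncation g y k x * g x ^+ 2)).
      exact: cvg_truncation.
    by apply/funext => k; rewrite /gt; case: (truncationP g y k x) => [->|[-> _ _]]; ring.
  - rewrite ger0_norm ?sqr_ge0// /gt.
    by case: (truncationP g y k x) => [->|[-> _ _]]; rewrite ?mul1r// mul0r expr0n sqr_ge0.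
apply: (@cvgr_to_le _ \oo _ _ (fun k => (\int[nu]_x (g x * y x) - c) ^+ 2 +
    sigma ^+ 2 / n%:R * \int[nu]_x (gt k x ^+ 2))); last exact: nearW.
by apply: cvgD; [exact: cvg_cst|apply: cvgM => //; exact: cvg_cst].
Qed.

End regression.

(** * Exchanging integrals over an arbitrary measure space *)

(** The integral of a nonnegative function is a supremum over the simple
    functions below it, hence is monotone in full generality.  In the risk, the
    squared norm over the whole of T is not known to be a measurable function of
    the sample, because mu may fail to be sigma-finite. *)
Lemma le_lower_integral {R : realType} d (T : measurableType d)
  (m : {measure set T -> \bar R}) (f1 f2 : T -> \bar R) :
  (forall t, (0 <= f1 t)%E) -> (forall t, (f1 t <= f2 t)%E) ->
  (\int[m]_t f1 t <= \int[m]_t f2 t)%E.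
Proof.
move=> f10 f12.
rewrite !ge0_integralTE//; last by move=> t; exact: le_trans (f12 t).
apply: ge_ereal_sup => _ [h hf1 <-].
by apply: ereal_sup_ubound; exists h => // t; exact: le_trans (hf1 t) (f12 t).
Qed.

Section tonelli.
Context {R : realType} {dO dT : measure_display}.
Context {Om : measurableType dO} {T : measurableType dT}.
Variables (P : probability Om R) (mu : {measure set T -> \bar R}).

(** Restricting the measure turns integration over a set of finite measure into
    integration against a finite measure, to which the theorem of Tonelli
    applies. *)
Lemma ge0_integral_mfrestr (D : set T) (mD : measurable D)
  (Doo : (mu D < +oo)%E) (h : T -> \bar R) : measurable_fun setT h ->
  (forall t, (0 <= h t)%E) ->
  (\int[mfrestr mD Doo]_t h t = \int[mu]_(t in D) h t)%E.
Proof.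
move=> mh h0.
rewrite (@ge0_negligible_integral _ _ _ _ setT (~` D))//; last 2 first.
- exact: measurableC.
- by rewrite -[LHS]/(mu (~` D `&` D)) setICl measure0.
rewrite setTD setCK; apply: eq_measure_integral => B mB BD.
by rewrite -[LHS]/(mu (B `&` D)) setIidl.
Qed.

(** The sets {G >= 1/(m+1)} have finite measure because G is integrable, and
    they exhaust the set where G does not vanish; the theorem of Tonelli on
    each of them gives the bound, and monotone convergence concludes. *)
Lemma tonelli_lower_bound (W : Om * T -> \bar R) (G : T -> R) :
  measurable_fun setT W -> (forall q, (0 <= W q)%E) ->
  (forall t, 0 <= G t) -> mu.-integrable setT (EFin \o G) ->
  (forall t, ((G t)%:E <= \int[P]_w W (w, t))%E) ->
  (\int[mu]_t (G t)%:E <= \int[P]_w \int[mu]_t W (w, t))%E.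
Proof.
move=> mW W0 G0 iG GW.
pose F (m : nat) := [set t | m.+1%:R^-1 <= G t].
have mG := integrable_measurable iG.
have mF m : measurable (F m).
  by rewrite /F -[X in measurable X]setTI; exact: measurable_fun_le.
have Foo m : (mu (F m) < +oo)%E.
  have m0 : 0 < m.+1%:R^-1 :> R by rewrite invr_gt0.
  have := le_integral_abse mu measurableT (measurable_int _ iG) m0.
  have /integrableP[_] := iG => /[swap] /le_lt_trans /[apply].
  rewrite setTI (_ : [set x | _] = F m); last first.
    by apply/seteqP; split => t /=; rewrite lee_fin ger0_norm.
  case: (mu (F m)) => [r _|/=|//]; first exact: ltry.
  by rewrite gt0_muley ?lte_fin.
have Fcup t : (\bigcup_m F m) t <-> 0 < G t.
  split=> [[m _]|Gt0]; first by apply: lt_le_trans; rewrite invr_gt0.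
  exists (Num.truncn (G t)^-1) => //=; rewrite /F/=.
  rewrite -[leRHS]invrK lef_pV2 ?posrE ?invr_gt0//.
  by rewrite ltW// truncnS_gt.
have step m : (\int[mu]_(t in F m) (G t)%:E <= \int[P]_w \int[mu]_t W (w, t))%E.
  have mWw w : measurable_fun setT (fun t => W (w, t)).
    by apply: measurableT_comp => //; exact: measurable_pair1.
  pose nuF := mfrestr (mF m) (Foo m).
  have mint : measurable_fun setT (fun t => \int[P]_w W (w, t))%E.
    exact: (measurable_fun_fubini_tonelli_G (m1 := P) W mW W0).
  apply: (@le_trans _ _ (\int[mu]_(t in F m) \int[P]_w W (w, t)))%E.
    apply: ge0_le_integral => //.
    - by move=> t _; rewrite lee_fin.
    - by apply: measurable_funTS; exact: (measurable_int _ iG).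
    - exact: measurable_funTS.
  rewrite -(ge0_integral_mfrestr (mF m) (Foo m))//; last first.
    by move=> t; exact: integral_ge0.
  rewrite -(fubini_tonelli (m1 := P) (m2 := nuF) W mW W0).
  apply: le_lower_integral => w; first exact: integral_ge0.
  rewrite ge0_integral_mfrestr//.
  by apply: ge0_subset_integral.
have mGE D : measurable_fun D (EFin \o G).
  by apply: measurable_funTS; exact: (measurable_int _ iG).
rewrite (_ : \int[mu]_t (G t)%:E = \int[mu]_(t in \bigcup_m F m) (G t)%:E)%E; last first.
  rewrite [RHS]integral_mkcond; apply: eq_integral => t _; rewrite /patch.
  case: ifPn => // /negP tF; congr EFin.
  apply/eqP; rewrite eq_le G0 andbT leNgt; apply/negP => Gt0; apply: tF.
  by rewrite inE; exact/Fcup.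
apply: (@cvge_to_le _ \oo _ _ (fun m => \int[mu]_(t in F m) (G t)%:E)%E); last exact: nearW.
apply: ge0_nondecreasing_set_cvg_integral => //.
- move=> m k mk; apply/subsetPset => t; apply: le_trans.
  by rewrite lef_pV2 ?posrE// ler_nat.
- by move=> m t _; rewrite lee_fin.
Qed.

End tonelli.

(** * Orthonormal families *)

(** With U, S and V the sums of the a_i b_i, a_i^2 and b_i^2, the sum of the
    squares of V a_i - U b_i equals V (S V - U^2). *)
Lemma sum_cauchy_schwarz {R : realFieldType} (J : eqType) (s : seq J) (a b : J -> R) :
  (\sum_(i <- s) a i * b i) ^+ 2 <= (\sum_(i <- s) a i ^+ 2) * (\sum_(i <- s) b i ^+ 2).
Proof.
set U := \sum_(i <- s) a i * b i; set S := \sum_(i <- s) a i ^+ 2.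
set V := \sum_(i <- s) b i ^+ 2.
have S0 : 0 <= S by apply: sumr_ge0 => i _; exact: sqr_ge0.
have V0 : 0 <= V by apply: sumr_ge0 => i _; exact: sqr_ge0.
have : 0 <= \sum_(i <- s) (a i * V - b i * U) ^+ 2.
  by apply: sumr_ge0 => i _; exact: sqr_ge0.
have -> : \sum_(i <- s) (a i * V - b i * U) ^+ 2 = V * (S * V - U ^+ 2).
  transitivity (\sum_(i <- s) (V ^+ 2 * a i ^+ 2 - 2 * V * U * (a i * b i) +
      U ^+ 2 * b i ^+ 2)).
    by apply: eq_bigr => i _; ring.
  by rewrite !big_split/= sumrN -!mulr_sumr -/S -/U -/V; ring.
have [V0'|Vneq0] := eqVneq V 0; last first.
  by rewrite pmulr_rge0 ?subr_ge0// lt_neqAle eq_sym Vneq0.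
move=> _; rewrite V0' mulr0; have -> : U = 0; last by rewrite expr0n.
have /eqP := V0'; rewrite /V psumr_eq0; last by move=> i _; exact: sqr_ge0.
move=> /allP b0; rewrite /U big1_seq// => i /b0; rewrite sqrf_eq0 => /eqP ->.
by rewrite mulr0.
Qed.

Section orthonormal.
Context {R : realType} {d : measure_display} {X : measurableType d}.
Variables (nu : {measure set X -> \bar R}) (I : choiceType) (e : I -> X -> R).
Hypothesis he : orthonormal_basis nu e.

Let eL i : e i \in Lfun nu 2%:E. Proof. by case: he. Qed.

Definition lincomb (s : seq I) (c : I -> R) : X -> R :=
  fun x => \sum_(i <- s) c i * e i x.

Lemma lincomb_L2 s c : lincomb s c \in Lfun nu 2%:E.
Proof. by apply: Lfun2_sum => i; exact: Lfun2Z. Qed.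

Lemma Rintegral_lincomb (g : X -> R) s c : g \in Lfun nu 2%:E ->
  \int[nu]_x (g x * lincomb s c x) = \sum_(i <- s) c i * \int[nu]_x (g x * e i x).
Proof.
move=> hg; have ge i := integrableM_L2 hg (eL i).
under eq_Rintegral => x _.
  rewrite /lincomb mulr_sumr; under eq_bigr do rewrite mulrCA; over.
rewrite Rintegral_sum; last by move=> i; exact: (integrableZl measurableT (c i) (ge i)).
by apply: eq_bigr => i _; rewrite (RintegralZl _ _ (ge i)).
Qed.

Lemma coef_lincomb s c j : uniq s -> j \in s ->
  \int[nu]_x (lincomb s c x * e j x) = c j.
Proof.
move=> us js; under eq_Rintegral do rewrite mulrC.
rewrite Rintegral_lincomb// (bigD1_seq j)//= big1.
  by rewrite addr0 -/(L2inner nu (e j) (e j)) (onb_orthonormal he) eqxx mulr1.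
move=> i ij; rewrite -/(L2inner nu (e j) (e i)) (onb_orthonormal he).
by rewrite eq_sym (negbTE ij) mulr0.
Qed.

Lemma L2norm_lincomb s c : uniq s ->
  L2norm nu (lincomb s c) ^+ 2 = \sum_(i <- s) c i ^+ 2.
Proof.
move=> us; rewrite L2norm_sqr; last exact: lincomb_L2.
under eq_Rintegral do rewrite expr2.
rewrite Rintegral_lincomb; last exact: lincomb_L2.
by apply: eq_big_seq => i si; rewrite coef_lincomb// expr2.
Qed.

(** Expand the nonnegative integral of (g - v)^2, where v is the projection of g
    on the span of the e_i with i in s. *)
Lemma bessel (g : X -> R) s : g \in Lfun nu 2%:E -> uniq s ->
  \sum_(i <- s) (\int[nu]_x (g x * e i x)) ^+ 2 <= \int[nu]_x (g x ^+ 2).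
Proof.
move=> hg us; pose c i := \int[nu]_x (g x * e i x).
have hv := lincomb_L2 s c.
have i1 := Lfun2_integrable_sqr hg.
have i2 := integrableM_L2 hg hv.
have i3 := Lfun2_integrable_sqr hv.
have i4 : nu.-integrable setT (EFin \o (fun x => 2 * (g x * lincomb s c x))).
  exact: (integrableZl measurableT _ i2).
have i5 : nu.-integrable setT (EFin \o (fun x => g x ^+ 2 - 2 * (g x * lincomb s c x))).
  exact: (integrableB measurableT i1 i4).
have : 0 <= \int[nu]_x ((g x ^+ 2 - 2 * (g x * lincomb s c x)) + lincomb s c x ^+ 2).
  apply: Rintegral_ge0 => x _.
  by rewrite (_ : _ + _ = (g x - lincomb s c x) ^+ 2) ?sqr_ge0//; ring.
rewrite (RintegralD _ i5 i3)// (RintegralB _ i1 i4)// (RintegralZl _ _ i2)//.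
rewrite -(L2norm_sqr hv) L2norm_lincomb// Rintegral_lincomb//.
rewrite (_ : \sum_(i <- s) c i * _ = \sum_(i <- s) c i ^+ 2).
  by rewrite -/c; lra.
by apply: eq_bigr => i _; rewrite expr2.
Qed.

(** Repeated indices in the approximating sum are merged, so that
    [L2norm_lincomb] applies. *)
Lemma onb_approx (z : X -> R) (eta : R) : z \in Lfun nu 2%:E -> 0 < eta ->
  exists s c, uniq s /\ L2norm nu (z \- lincomb s c) < eta.
Proof.
move=> hz eta0; have [s [c zsc]] := onb_total he hz eta0.
exists (undup s), (fun i => c i *+ count_mem i s); split; first exact: undup_uniq.
congr (_ < _): zsc; congr L2norm; apply/funext => x /=; congr (_ - _).
rewrite /lincomb -(big_undup_iterop_count _ s xpredT).
by apply: eq_bigr => i _; rewrite mulrnAl.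
Qed.

End orthonormal.

(** * Hilbert-Schmidt norm and risk *)

Section kernel_operator.
Context {R : realType} {dT dX : measure_display}.
Context {T : measurableType dT} {X : measurableType dX}.
Variables (mu : {measure set T -> \bar R}) (nu : probability X R).
Variables (I : choiceType) (e : I -> X -> R).
Hypothesis he : orthonormal_basis nu e.
Variable l : X -> T -> R.
Hypothesis hl : L2_kernel mu nu l.
Hypothesis lL2 : forall z, z \in Lfun nu 2%:E -> kernel_op nu l z \in Lfun mu 2%:E.

Local Notation L := (kernel_op nu l).
Local Notation H := (HSnorm mu e L).

Let eL i : e i \in Lfun nu 2%:E. Proof. by case: he. Qed.

Let Lint t z : z \in Lfun nu 2%:E ->
  nu.-integrable setT (EFin \o (fun x => l x t * z x)).
Proof. by move=> hz; apply: integrableM_L2 => //; exact: (kernel_L2X hl t). Qed.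

Lemma kernel_opB z v : z \in Lfun nu 2%:E -> v \in Lfun nu 2%:E ->
  L (z \- v) = L z \- L v.
Proof.
move=> hz hv; apply/funext => t; rewrite /kernel_op/=.
under eq_Rintegral do rewrite mulrBr.
by rewrite RintegralB//; exact: Lint.
Qed.

Lemma kernel_op_lincomb s c :
  L (lincomb e s c) = (fun t => \sum_(i <- s) c i * L (e i) t).
Proof.
apply/funext => t; rewrite /kernel_op (Rintegral_lincomb he)//.
exact: (kernel_L2X hl t).
Qed.

Lemma HSnorm_ge0 : 0 <= H. Proof. exact: sqrtr_ge0. Qed.

Let a i := ('N[mu]_2%:E[EFin \o L (e i)] ^+ 2)%E.

Let aE i : a i = (L2norm mu (L (e i)) ^+ 2)%:E.
Proof. by rewrite /a Lnorm2_sqr L2norm_sqrE//; exact: lL2. Qed.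

Hypothesis H_neq0 : H != 0.

(** A nonzero value of [HSnorm] certifies that the sum is finite, since an
    infinite one is sent to 0. *)
Lemma HSnorm_sqrE : (H ^+ 2)%:E = (\esum_(i in [set: I]) a i)%E.
Proof.
have E0 : (0 <= \esum_(i in [set: I]) a i)%E.
  by apply: esum_ge0 => i _; rewrite aE lee_fin sqr_ge0.
move: H_neq0; rewrite /HSnorm -/(a _).
case: (\esum_(i in [set: I]) a i)%E E0 => [r|_|//] /=; last by rewrite sqrtr0 eqxx.
by rewrite lee_fin => r0 _; rewrite sqr_sqrtr.
Qed.

Lemma sum_le_HSnorm s : uniq s ->
  \sum_(i <- s) L2norm mu (L (e i)) ^+ 2 <= H ^+ 2.
Proof.
move=> us; rewrite -lee_fin HSnorm_sqrE; apply: esum_ge.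
exists [set` s]; first by split.
rewrite -fsbig_seq//= (eq_bigr (fun i => (L2norm mu (L (e i)) ^+ 2)%:E)) ?sumEFin//.
Qed.

Lemma HSnorm_le (M : R) :
  (forall s, uniq s -> \sum_(i <- s) L2norm mu (L (e i)) ^+ 2 <= M) -> H ^+ 2 <= M.
Proof.
move=> hM; rewrite -lee_fin HSnorm_sqrE; apply: ge_ereal_sup => _ [A [fA _] <-].
rewrite fsbig_finite//= (eq_bigr (fun i => (L2norm mu (L (e i)) ^+ 2)%:E)).
  by rewrite sumEFin lee_fin; apply: hM; exact: finmap.fset_uniq.
by move=> i _; exact: aE.
Qed.

(** The operator norm is at most the Hilbert-Schmidt norm.  On finite
    combinations of the basis this is the inequality of Cauchy and Schwarz;
    the a priori bound C, whatever its size, extends it to their closure. *)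
Lemma L2norm_kernel_op_le (z : X -> R) : z \in Lfun nu 2%:E ->
  (exists C : R, forall z, z \in Lfun nu 2%:E -> L2norm mu (L z) <= C * L2norm nu z) ->
  L2norm mu (L z) <= H * L2norm nu z.
Proof.
move=> hz [C hC]; apply/ler_addgt0Pr => eps eps0.
pose D := `|C| + H + 1.
have D0 : 0 < D by rewrite ltr_wpDl// addr_ge0// HSnorm_ge0.
have [s [c [us zsc]]] := onb_approx he hz (divr_gt0 eps0 D0).
set v := lincomb e s c; have hv : v \in Lfun nu 2%:E by exact: (lincomb_L2 he).
set w := z \- v; have hw : w \in Lfun nu 2%:E by exact: Lfun2B.
have Lz : L z = L v \+ L w.
  by rewrite /w kernel_opB//; apply/funext => t /=; rewrite addrC subrK.
have vz : L2norm nu v <= L2norm nu z + L2norm nu w.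
  have -> : v = z \+ (fun x => -1 * w x).
    by apply/funext => x /=; rewrite /w/= mulN1r opprB addrC subrK.
  rewrite (le_trans (L2normD hz (Lfun2Z (-1) hw)))// L2normZ//.
  by rewrite normrN1 mul1r.
have Lv : L2norm mu (L v) <= H * L2norm nu v.
  have Lei i : L (e i) \in Lfun mu 2%:E by exact: lL2.
  rewrite -(@ler_pXn2r _ 2) ?nnegrE ?mulr_ge0 ?HSnorm_ge0 ?L2norm_ge0//.
  rewrite exprMn (L2norm_lincomb he)// L2norm_sqr; last exact: lL2.
  apply: (@le_trans _ _ (\int[mu]_t ((\sum_(i <- s) c i ^+ 2) *
      (\sum_(i <- s) L (e i) t ^+ 2)))).
    apply: le_Rintegral => //.
    - by apply: Lfun2_integrable_sqr; exact: lL2.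
    - apply: (integrableZl measurableT _ (f := EFin \o (fun t => \sum_(i <- s) L (e i) t ^+ 2))).
      by apply: integrable_sumR => i; exact: Lfun2_integrable_sqr.
    - by move=> t _; rewrite kernel_op_lincomb; exact: sum_cauchy_schwarz.
  rewrite RintegralZl//; last by apply: integrable_sumR => i; exact: Lfun2_integrable_sqr.
  rewrite mulrC ler_wpM2r//; first by apply: sumr_ge0 => i _; exact: sqr_ge0.
  rewrite Rintegral_sum; last by move=> i; exact: Lfun2_integrable_sqr.
  rewrite (le_trans _ (sum_le_HSnorm us))//.
  by rewrite le_eqVlt; apply/orP; left; apply/eqP/eq_bigr => i _; rewrite L2norm_sqr.
rewrite Lz (le_trans (L2normD (lL2 hv) (lL2 hw)))//.
have w0 := L2norm_ge0 nu w.
have step : (`|C| + H) * L2norm nu w <= eps.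
  have : D * L2norm nu w <= eps by rewrite mulrC -ler_pdivlMr// ltW.
  by apply: le_trans; rewrite ler_wpM2r// lerDl.
have h1 : H * L2norm nu v <= H * L2norm nu z + H * L2norm nu w.
  by rewrite -mulrDr ler_wpM2l// HSnorm_ge0.
have h2 : L2norm mu (L w) <= `|C| * L2norm nu w.
  by rewrite (le_trans (hC w hw))// ler_wpM2r// ler_norm.
by move: step; rewrite mulrDl; lra.
Qed.

End kernel_operator.

Section risk_lower_bound.
Context {R : realType} {dT dX dO : measure_display}.
Context {T : measurableType dT} {X : measurableType dX} {Om : measurableType dO}.
Variables (mu : {measure set T -> \bar R}).
Variables (rho : probability (X * measurableTypeR R)%type R) (nu : probability X R).
Hypothesis hnu : is_marginal rho nu.
Variables (I : choiceType) (e : I -> X -> R).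
Hypothesis he : orthonormal_basis nu e.
Variables (y : X -> R) (sigma : R).
Hypothesis hy : y \in Lfun nu 2%:E.
Hypothesis hrho : regression_model rho nu y sigma.
Variables (P : probability Om R).
Variable (Z : nat -> {RV P >-> (X * measurableTypeR R)%type}).
Hypothesis hZ : iid_sample rho Z.
Variable fdag : T -> R.
Hypothesis hf : fdag \in Lfun mu 2%:E.
Variable l : X -> T -> R.
Hypothesis hl : L2_kernel mu nu l.
Hypothesis lL2 : forall z, z \in Lfun nu 2%:E -> kernel_op nu l z \in Lfun mu 2%:E.
Local Notation L := (kernel_op nu l).
Variable n : nat.
Hypothesis n0 : (0 < n)%N.

Lemma fhat_L2 w : fhat Z l n w \in Lfun mu 2%:E.
Proof.
apply: Lfun2Z; apply: (Lfun2_sum _ (h := fun (i : 'I_n) t => l (Z i w).1 t * (Z i w).2)) => i.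
under eq_fun do rewrite mulrC.
by apply: Lfun2Z; exact: (kernel_L2T hl).
Qed.

Lemma measurable_fhat :
  measurable_fun setT (fun q : Om * T => fhat Z l n q.1 q.2 - fdag q.2).
Proof.
apply: measurable_funB; last exact: (measurableT_comp (Lfun2_measurable hf)).
apply: measurable_funM => //; apply: measurable_sum => i.
have mZ : measurable_fun setT (fun q : Om * T => Z i q.1).
  exact: (measurableT_comp (measurable_sample Z i)).
apply: measurable_funM; last exact: (measurableT_comp measurable_snd mZ).
apply: (measurableT_comp (kernel_meas hl) (g := fun q : Om * T => ((Z i q.1).1, q.2))).
apply: measurable_fun_pair; last exact: measurable_snd.
exact: (measurableT_comp measurable_fst mZ).
Qed.

Lemma risk_ge0 : (0 <= risk mu Z l fdag n)%E.
Proof.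
by rewrite /risk unlock; apply: integral_ge0 => w _; rewrite lee_fin sqr_ge0.
Qed.

(** [sample_mean_risk_ge] at each t, followed by the inequality of Bessel for
    l(., t), whose coefficients are the values L e_i(t).  A finite partial sum
    keeps the lower bound integrable over T, as [tonelli_lower_bound]
    requires. *)
Lemma risk_ge_partial_sum s : uniq s ->
  ((L2norm mu (L y \- fdag) ^+ 2 +
    sigma ^+ 2 / n%:R * \sum_(i <- s) L2norm mu (L (e i)) ^+ 2)%:E <=
   risk mu Z l fdag n)%E.
Proof.
move=> us; have eL i : e i \in Lfun nu 2%:E by case: he.
have hb : L y \- fdag \in Lfun mu 2%:E by apply: Lfun2B => //; exact: lL2.
have hL i : L (e i) \in Lfun mu 2%:E by exact: lL2.
pose G t := (L y t - fdag t) ^+ 2 + sigma ^+ 2 / n%:R * \sum_(i <- s) L (e i) t ^+ 2.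
have s0 : 0 <= sigma ^+ 2 / n%:R by rewrite mulr_ge0 ?sqr_ge0.
have i1 := Lfun2_integrable_sqr hb.
have i2 : mu.-integrable setT (EFin \o (fun t => \sum_(i <- s) L (e i) t ^+ 2)).
  by apply: integrable_sumR => i; exact: Lfun2_integrable_sqr.
have i3 := integrableZl measurableT (sigma ^+ 2 / n%:R) i2.
have iG : mu.-integrable setT (EFin \o G) by exact: (integrableD measurableT i1 i3).
have -> : (L2norm mu (L y \- fdag) ^+ 2 +
    sigma ^+ 2 / n%:R * \sum_(i <- s) L2norm mu (L (e i)) ^+ 2)%:E =
    (\int[mu]_t (G t)%:E)%E.
  rewrite -[RHS]fineK; last exact: integrable_fin_num.
  rewrite -/(Rintegral mu setT G) (RintegralD _ i1 i3)// RintegralZl//.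
  rewrite L2norm_sqr// Rintegral_sum; last by move=> i; exact: Lfun2_integrable_sqr.
  by congr ((_ + _ * _)%:E); apply: eq_bigr => i _; rewrite L2norm_sqr.
pose W (q : Om * T) := ((fhat Z l n q.1 q.2 - fdag q.2) ^+ 2)%:E.
apply: (@le_trans _ _ (\int[P]_w \int[mu]_t W (w, t))%E); last first.
  rewrite /risk unlock; apply: le_lower_integral => w.
    by apply: integral_ge0 => t _; rewrite lee_fin sqr_ge0.
  by rewrite /= L2norm_sqrE//; apply: Lfun2B => //; exact: fhat_L2.
apply: tonelli_lower_bound => //.
- by apply/measurable_EFinP; apply: measurable_funX; exact: measurable_fhat.
- by move=> q; rewrite lee_fin sqr_ge0.
- move=> t; rewrite addr_ge0 ?sqr_ge0// mulr_ge0// sumr_ge0// => i _.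
  exact: sqr_ge0.
move=> t; have lt := kernel_L2X hl t.
have := sample_mean_risk_ge hnu hy hrho hZ (fdag t) n0 lt.
apply: le_trans; rewrite lee_fin lerD2l ler_wpM2l//.
exact: (bessel he lt us).
Qed.

Hypothesis sigma_neq0 : sigma != 0.
Hypothesis H_neq0 : HSnorm mu e L != 0.
Hypothesis risk_fin : (risk mu Z l fdag n < +oo)%E.

(** The variance term of the risk: the supremum over finite families of basis
    vectors yields the Hilbert-Schmidt norm. *)
Lemma risk_ge : L2norm mu (L y \- fdag) ^+ 2 + sigma ^+ 2 / n%:R * HSnorm mu e L ^+ 2 <=
  fine (risk mu Z l fdag n).
Proof.
have rfin : risk mu Z l fdag n \is a fin_num by rewrite ge0_fin_numE// risk_ge0.
have s0 : 0 < sigma ^+ 2 / n%:R.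
  by rewrite divr_gt0 ?ltr0n// lt_neqAle sqr_ge0 eq_sym sqrf_eq0 sigma_neq0.
rewrite -lerBrDl mulrC -ler_pdivlMr//.
apply: (HSnorm_le he) => // s us.
rewrite ler_pdivlMr// mulrC lerBrDl -lee_fin fineK//.
exact: risk_ge_partial_sum.
Qed.

End risk_lower_bound.

(** * Asymptotic comparisons and the two rates *)

Section landau.
Context {R : realType}.

Lemma near_rightP (Q : R -> Prop) :
  (\forall x \near 0^'+, Q x) <-> exists2 r, 0 < r & forall x, 0 < x < r -> Q x.
Proof.
split=> [[r /= r0 hr]|[r r0 hr]].
  exists r => // x /andP[x0 xr]; apply: hr => //=.
  by rewrite sub0r normrN gtr0_norm.
near=> x; apply: hr; apply/andP; split; near: x.
  exact: nbhs_right_gt.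
exact: nbhs_right_lt.
Unshelve. all: by end_near. Qed.

Lemma eqTheta_exP (T : Type) (F : filter_on T) (f g : T -> R) :
  f =Theta_F g <-> exists2 k : R * R, (0 < k.1) && (0 < k.2) &
    \forall x \near F, k.1 * `|g x| <= `|f x| /\ `|f x| <= k.2 * `|g x|.
Proof. by rewrite eqThetaE; split => [/asboolP|h]; [|apply/asboolP]. Qed.

Lemma powR_sandwich (a b x y s : R) : 0 <= a -> 0 <= b -> 0 <= x -> 0 <= y -> 0 <= s ->
  a * x <= y <= b * x -> a `^ s * x `^ s <= y `^ s <= b `^ s * x `^ s.
Proof.
move=> a0 b0 x0 y0 s0 /andP[ay yb].
by rewrite -!powRM// !ge0_ler_powR// nnegrE mulr_ge0.
Qed.

Lemma powR_natV (n : nat) (s : R) : n%:R `^ (- s) = n%:R^-1 `^ s.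
Proof. by rewrite -powR_inv1// -powRrM mulN1r. Qed.

Lemma natV_powR_lt (c s : R) : 0 < c -> 0 < s ->
  \forall n \near \oo, n%:R^-1 `^ s < c.
Proof.
move=> c0 s0; exists (Num.truncn (c `^ s^-1)^-1).+1 => // n /= hn.
have n0 : (0 < n)%N by exact: leq_trans hn.
have cs0 : 0 < c `^ s^-1 by exact: powR_gt0.
have -> : c = (c `^ s^-1) `^ s by rewrite -powRrM mulVf ?gt_eqF// powRr1// ltW.
rewrite gt0_ltr_powR ?nnegrE ?invr_ge0// ?(ltW cs0)//.
rewrite invf_plt ?posrE ?ltr0n//.
by rewrite (lt_le_trans (truncnS_gt _))// ler_nat.
Qed.

End landau.

Section rate_arithmetic.
Context {R : realType}.
Implicit Types (V d u q e : R).

(** Here u stands for 1/n, V for sigma^2 and e for eps(lambda).  With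
    v = sqrt u the assumptions give V v^2 <= 2 d^2 + 4 c d v, which forces
    v <= K d as soon as K >= 1 and K V >= 2 + 4 c. *)
Lemma rate_fast V c q d u e : 0 < V -> 0 < c -> 2^-1 <= q ->
  0 < d -> 0 < u <= 1 -> 0 <= e <= c * u `^ q ->
  d ^+ 2 + 2 * d * e <= V * u -> V * u <= 2 * (d ^+ 2 + 2 * d * e) ->
  V^-1 * d `^ 2 <= u <= (1 + (2 + 4 * c) / V) ^+ 2 * d `^ 2.
Proof.
move=> V0 c0 q2 d0 /andP[u0 u1] /andP[e0 ec] lo hi.
rewrite powR_mulrn ?(ltW d0)// -exprMn; apply/andP; split.
  rewrite ler_pdivrMl//; apply: le_trans lo; rewrite lerDl.
  by rewrite mulr_ge0// mulr_ge0// ltW.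
set K := 1 + _; pose v := u `^ 2^-1.
have v0 : 0 < v by exact: powR_gt0.
have v2 : u = v ^+ 2.
  by rewrite -powR_mulrn ?(ltW v0)// -powRrM mulVf ?powRr1 ?(ltW u0)// pnatr_eq0.
have uqv : u `^ q <= v by apply: ger_powR => //; rewrite u0.
have ev : e <= c * v by rewrite (le_trans ec)// ler_wpM2l// ltW.
have KV : K * V = V + 2 + 4 * c.
  by rewrite /K mulrDl mul1r divfK ?gt_eqF// addrA.
have K1 : 1 <= K by rewrite /K lerDl divr_ge0 ?ltW// addr_gt0// mulr_gt0.
rewrite v2 lerXn2r ?nnegrE ?mulr_ge0 ?(ltW d0) ?(ltW v0)//; first lra.
rewrite leNgt; apply/negP => Kdv.
have dv : d <= v by rewrite (le_trans _ (ltW Kdv))// ler_peMl// ltW.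
have h1 : d * e <= d * (c * v) by rewrite ler_wpM2l// ltW.
have h2 : V * v ^+ 2 <= 2 * d ^+ 2 + 4 * c * (d * v) by rewrite -v2; lra.
have h3 : K * (V * v ^+ 2) <= K * (2 * d ^+ 2 + 4 * c * (d * v)).
  by rewrite ler_wpM2l// (le_trans ler01).
have h4 : K * d * d <= v * v by rewrite ler_pM// ?ltW// mulr_gt0// (lt_le_trans ltr01).
have h5 : c * (K * d * v) <= c * (v * v).
  by rewrite ler_wpM2l ?(ltW c0)// ler_wpM2r ?(ltW v0)// ltW.
have h6 : K * (V * v ^+ 2) = (V + 2 + 4 * c) * v ^+ 2 by rewrite mulrA KV.
have h7 : 0 < V * v ^+ 2 by rewrite mulr_gt0// exprn_gt0.
nra.
Qed.

(** The term d e already gives d = O(u^(1-q)), and u^(1-q) <= u^q since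
    u <= 1 and q < 1/2; hence d^2 = O(d u^q) is dominated by d e, and
    u = Theta(d u^q). *)
Lemma rate_slow V c1 c2 q d u e : 0 < V -> 0 < c1 -> 0 < c2 -> q < 2^-1 ->
  0 < d -> 0 < u <= 1 -> c1 * u `^ q <= e <= c2 * u `^ q ->
  d ^+ 2 + 2 * d * e <= V * u -> V * u <= 2 * (d ^+ 2 + 2 * d * e) ->
  (2 * c1 / V) `^ (1 - q)^-1 * d `^ (1 - q)^-1 <= u <=
  (2 * (V / (2 * c1) + 2 * c2) / V) `^ (1 - q)^-1 * d `^ (1 - q)^-1.
Proof.
move=> V0 c10 c20 q2 d0 /andP[u0 u1] /andP[ec1 ec2] lo hi.
set r := 1 - q; have r0 : 0 < r by rewrite /r; lra.
have uq0 : 0 < u `^ q by exact: powR_gt0.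
have ur0 : 0 < u `^ r by exact: powR_gt0.
have uE : u = u `^ q * u `^ r.
  rewrite -powRD; last by rewrite (gt_eqF u0) implybT.
  by rewrite /r addrC subrK powRr1// ltW.
have urq : u `^ r <= u `^ q.
  by apply: ger_powR; rewrite ?u0//; rewrite /r; lra.
have E : u = (u `^ r) `^ r^-1 by rewrite -powRrM divff ?gt_eqF// powRr1// ltW.
have h1 : 2 * c1 * d <= V * u `^ r.
  rewrite -(ler_pM2r uq0).
  have : d * (c1 * u `^ q) <= d * e by rewrite ler_wpM2l// ltW.
  have := sqr_ge0 d; move: lo; rewrite {1}uE; lra.
have h1' : d <= V / (2 * c1) * u `^ r.
  by rewrite mulrAC ler_pdivlMr ?mulr_gt0// mulrC.
have h2 : d <= V / (2 * c1) * u `^ q.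
  by rewrite (le_trans h1')// ler_wpM2l// divr_ge0 ?mulr_ge0// ltW.
have h3 : V * u `^ r <= 2 * (V / (2 * c1) + 2 * c2) * d.
  rewrite -(ler_pM2r uq0).
  have : d * e <= d * (c2 * u `^ q) by rewrite ler_wpM2l// ltW.
  have : d * d <= d * (V / (2 * c1) * u `^ q) by rewrite ler_wpM2l// ltW.
  by move: hi; rewrite {1}uE; lra.
have K0 : 0 < V / (2 * c1) + 2 * c2 by rewrite addr_gt0// ?divr_gt0// mulr_gt0.
rewrite [X in _ <= X <= _]E; apply: powR_sandwich.
- by rewrite divr_ge0 ?mulr_ge0// ltW.
- by rewrite divr_ge0 ?mulr_ge0// ltW.
- exact: ltW.
- exact: ltW.
- by rewrite invr_ge0 ltW.
- by rewrite !(mulrAC _ V^-1) ler_pdivrMr// ler_pdivlMr// [_ * V]mulrC h1 h3.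
Qed.

End rate_arithmetic.

(** * The number of samples associated with a noise level *)

Section parameter_choice.
Context {R : realType}.
Variables (sigma : R) (ep : R -> R) (Ln : nat -> R) (Ld : R -> R).
Hypothesis ep0 : forall l, 0 <= ep l.
Hypothesis hLd : associated_choice sigma ep Ln Ld.
Local Notation nt := (n_tilde sigma ep Ld).

(** If sigma = 0 then n_tilde vanishes identically and every delta > 0 lies in
    the image, so delta_tilde 0 would have to take all positive values. *)
Lemma associated_sigma_neq0 : sigma != 0.
Proof.
apply/eqP => s0.
have N0 d l : Nsamples sigma ep d l = 0 by rewrite /Nsamples s0 expr0n mul0r.
have nt0 d : nt d = 0%N by rewrite /n_tilde N0 truncn0.
have Im d : 0 < d -> Im_delta_tilde sigma ep Ld d by move=> d0; split; rewrite // N0.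
have := assoc_id hLd (Im 1 ltr01); have := assoc_id hLd (Im 2 (ltr0n _ 2)).
rewrite !nt0 => -> /eqP; rewrite -subr_eq0.
by rewrite (_ : 2 - 1 = 1 :> R) ?oner_eq0//; ring.
Qed.

Let V0 : 0 < sigma ^+ 2.
Proof. by rewrite lt_neqAle sqr_ge0 eq_sym sqrf_eq0 associated_sigma_neq0. Qed.

Let den_gt0 d l : 0 < d -> 0 < d ^+ 2 + 2 * d * ep l.
Proof. by move=> d0; rewrite ltr_pwDl ?exprn_gt0// mulr_ge0// mulr_ge0// ltW. Qed.

Let Nsamples_ge0 d l : 0 < d -> 0 <= Nsamples sigma ep d l.
Proof. by move=> d0; rewrite /Nsamples ltW// divr_gt0// den_gt0. Qed.

(** Each value M is taken only away from 0: where n_tilde delta = M the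
    parameter is the fixed number Ln M, and sigma^2 / (delta^2 + 2 delta e) with
    e fixed exceeds M + 1 for small delta. *)
Lemma n_tilde_large (M : nat) : \forall d \near 0^'+, (M <= nt d)%N.
Proof.
elim: M => [|M ih]; first exact: nearW.
have ac := assoc_choice hLd.
pose K := M.+1%:R * (1 + 2 * ep (Ln M)).
have K0 : 0 < K by rewrite mulr_gt0// ltr_pwDl// mulr_ge0.
near=> d.
have d0 : 0 < d by near: d; exact: nbhs_right_gt.
have d1 : d < 1 by near: d; apply: nbhs_right_lt.
have dK : d < sigma ^+ 2 / K by near: d; apply: nbhs_right_lt; exact: divr_gt0.
have Md : (M <= nt d)%N by near: d.
rewrite ltn_neqAle Md andbT; apply/eqP => Mnt.
have LdM : Ld d = Ln M by rewrite Mnt; near: d.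
have : (nt d < M.+1)%N by rewrite -Mnt.
rewrite /n_tilde LdM truncn_lt_nat ?Nsamples_ge0// /Nsamples.
rewrite ltr_pdivrMr ?den_gt0//; apply/negP; rewrite -leNgt.
have /ltW : K * d < sigma ^+ 2 by rewrite mulrC -ltr_pdivlMr.
apply: le_trans; rewrite (_ : K * d = M.+1%:R * (d + 2 * d * ep (Ln M))).
  by rewrite ler_wpM2l// lerD2r expr2 ler_piMr// ltW.
by rewrite /K; ring.
Unshelve. all: by end_near. Qed.

Lemma n_tilde_bounds d : 0 < d -> (0 < nt d)%N ->
  let u := (nt d)%:R^-1 in
  d ^+ 2 + 2 * d * ep (Ld d) <= sigma ^+ 2 * u /\
  sigma ^+ 2 * u <= 2 * (d ^+ 2 + 2 * d * ep (Ld d)).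
Proof.
move=> d0 n0 u; have D0 := den_gt0 (Ld d) d0; set D := d ^+ 2 + _ in D0 *.
have n0R : 0 < (nt d)%:R :> R by rewrite ltr0n.
have /andP[lo hi] := truncn_itv (Nsamples_ge0 (Ld d) d0).
rewrite -/(nt d) in lo hi.
rewrite /u; split.
  rewrite ler_pdivlMr// mulrC.
  by move: lo; rewrite /Nsamples ler_pdivlMr.
rewrite ler_pdivrMr//.
move: hi; rewrite /Nsamples ltr_pdivrMr// => /ltW /le_trans; apply.
rewrite (_ : 2 * D * (nt d)%:R = ((nt d)%:R + (nt d)%:R) * D); last by ring.
by rewrite ler_wpM2r ?(ltW D0)// -natr1 lerD2l ler1n.
Qed.

Variables (p gamma : R).
Hypotheses (p0 : 0 < p) (gamma0 : 0 < gamma).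
Hypothesis Ln_gt0 : forall n, (0 < n)%N -> 0 < Ln n.
Hypothesis hLn : Ln =Theta_\oo (fun n : nat => n%:R `^ (- p)).
Hypothesis hep : ep =Theta_ (0^'+) (fun l => l `^ gamma).

Local Notation u d := ((nt d)%:R^-1 : R).

Lemma near_n_tilde (Q : nat -> Prop) :
  (\forall n \near \oo, Q n) -> \forall d \near 0^'+, Q (nt d).
Proof.
move=> [N _ hN]; near=> d; apply: hN => /=; near: d; exact: n_tilde_large.
Unshelve. all: by end_near. Qed.

Lemma Ln_sandwich : exists2 a : R * R, 0 < a.1 /\ 0 < a.2 &
  \forall n \near \oo, a.1 * n%:R^-1 `^ p <= Ln n <= a.2 * n%:R^-1 `^ p.
Proof.
have /eqTheta_exP[a /andP[a1 a2] ha] := hLn; exists a => //.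
near=> n.
have n0 : (0 < n)%N by near: n; exists 1%N.
have [] : a.1 * `|n%:R `^ (- p)| <= `|Ln n| /\ `|Ln n| <= a.2 * `|n%:R `^ (- p)|.
  by near: n.
rewrite (ger0_norm (powR_ge0 _ _)) (gtr0_norm (Ln_gt0 n0)) powR_natV.
by move=> -> ->.
Unshelve. all: by end_near. Qed.

Lemma near_Ln (Q : R -> Prop) :
  (\forall l \near 0^'+, Q l) -> \forall n \near \oo, Q (Ln n).
Proof.
move=> /near_rightP[r r0 hr]; have [a [a1 a2] ha] := Ln_sandwich.
near=> n; apply: hr; rewrite Ln_gt0/=; last by near: n; exists 1%N.
have /andP[_ /le_lt_trans] : a.1 * n%:R^-1 `^ p <= Ln n <= a.2 * n%:R^-1 `^ p.
  by near: n.
apply; rewrite mulrC -ltr_pdivlMr//; near: n; apply: natV_powR_lt => //.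
exact: divr_gt0.
Unshelve. all: by end_near. Qed.

Lemma ep_Ln_sandwich : exists2 b : R * R, 0 < b.1 /\ 0 < b.2 &
  \forall n \near \oo, b.1 * n%:R^-1 `^ (p * gamma) <= ep (Ln n) <=
    b.2 * n%:R^-1 `^ (p * gamma).
Proof.
have /eqTheta_exP[b /andP[b1 b2] hb] := hep.
have [a [a1 a2] ha] := Ln_sandwich.
exists (b.1 * a.1 `^ gamma, b.2 * a.2 `^ gamma).
  by split; rewrite mulr_gt0// powR_gt0.
have hb' := near_Ln hb.
near=> n.
have n0 : (0 < n)%N by near: n; exists 1%N.
have [] : b.1 * `|Ln n `^ gamma| <= `|ep (Ln n)| /\ `|ep (Ln n)| <= b.2 * `|Ln n `^ gamma|.
  by near: n.
rewrite (ger0_norm (powR_ge0 _ _)) (ger0_norm (ep0 _)) => lo hi.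
have hn : a.1 * n%:R^-1 `^ p <= Ln n <= a.2 * n%:R^-1 `^ p by near: n.
have /andP[h1 h2] : a.1 `^ gamma * (n%:R^-1 `^ p) `^ gamma <= Ln n `^ gamma <=
    a.2 `^ gamma * (n%:R^-1 `^ p) `^ gamma.
  apply: powR_sandwich hn; rewrite ?powR_ge0 ?(ltW gamma0) ?(ltW a1) ?(ltW a2)//.
  exact/ltW/Ln_gt0.
rewrite -powRrM in h1 h2 => /=; apply/andP; split.
  by rewrite (le_trans _ lo)// -mulrA ler_wpM2l// ltW.
by rewrite (le_trans hi)// -mulrA ler_wpM2l// ltW.
Unshelve. all: by end_near. Qed.

(** The power of delta to which 1 / n_tilde delta is comparable. *)
Definition rate_exponent : R := if 2^-1 <= p * gamma then 2 else (1 - p * gamma)^-1.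

Lemma n_tilde_rate : exists2 k : R * R, 0 < k.1 /\ 0 < k.2 &
  \forall d \near 0^'+, k.1 * d `^ rate_exponent <= u d <= k.2 * d `^ rate_exponent.
Proof.
have [b [b1 b2] hb] := ep_Ln_sandwich; have hb' := near_n_tilde hb.
have ac := assoc_choice hLd.
have key : \forall d \near 0^'+, [/\ 0 < d, 0 < u d <= 1,
    b.1 * u d `^ (p * gamma) <= ep (Ld d) <= b.2 * u d `^ (p * gamma),
    d ^+ 2 + 2 * d * ep (Ld d) <= sigma ^+ 2 * u d &
    sigma ^+ 2 * u d <= 2 * (d ^+ 2 + 2 * d * ep (Ld d))].
  near=> d.
  have d0 : 0 < d by near: d; exact: nbhs_right_gt.
  have n0 : (0 < nt d)%N by near: d; exact: n_tilde_large.
  have [lo hi] := n_tilde_bounds d0 n0; split => //.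
    by rewrite invr_gt0 ltr0n n0/= invf_le1 ?ltr0n// ler1n.
  have -> : Ld d = Ln (nt d) by near: d.
  by near: d.
rewrite /rate_exponent; case: lerP => pg.
- exists ((sigma ^+ 2)^-1, (1 + (2 + 4 * b.2) / sigma ^+ 2) ^+ 2).
    split; first by rewrite invr_gt0.
    by rewrite exprn_gt0// addr_gt0// divr_gt0// addr_gt0// mulr_gt0.
  apply: filterS key => d [d0 u1 /andP[_ e2] lo hi].
  by apply: (rate_fast V0 b2 pg d0 u1 _ lo hi); rewrite ep0.
- exists ((2 * b.1 / sigma ^+ 2) `^ (1 - p * gamma)^-1,
    (2 * (sigma ^+ 2 / (2 * b.1) + 2 * b.2) / sigma ^+ 2) `^ (1 - p * gamma)^-1).
    split; apply: powR_gt0; first by rewrite divr_gt0// mulr_gt0.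
    by rewrite divr_gt0// mulr_gt0// addr_gt0 ?divr_gt0// mulr_gt0.
  apply: filterS key => d [d0 u1 e12 lo hi].
  exact: (rate_slow V0 b1 b2 pg d0 u1 e12 lo hi).
Unshelve. all: by end_near. Qed.

Lemma Ld_rate : Ld =Theta_ (0^'+) (fun d => d `^ (rate_exponent * p)).
Proof.
have [k [k1 k2] hk] := n_tilde_rate; have [a [a1 a2] ha] := Ln_sandwich.
have ha' := near_n_tilde ha; have ac := assoc_choice hLd.
apply/eqTheta_exP; exists (a.1 * k.1 `^ p, a.2 * k.2 `^ p).
  by rewrite /= !mulr_gt0 ?powR_gt0.
near=> d.
have -> : Ld d = Ln (nt d) by near: d.
have n0 : (0 < nt d)%N by near: d; exact: n_tilde_large.
rewrite (ger0_norm (powR_ge0 _ _)) (gtr0_norm (Ln_gt0 n0)).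
have /andP[lo hi] : a.1 * u d `^ p <= Ln (nt d) <= a.2 * u d `^ p by near: d.
have hu : k.1 * d `^ rate_exponent <= u d <= k.2 * d `^ rate_exponent by near: d.
have /andP[h1 h2] : k.1 `^ p * (d `^ rate_exponent) `^ p <= u d `^ p <=
    k.2 `^ p * (d `^ rate_exponent) `^ p.
  apply: powR_sandwich hu; rewrite ?powR_ge0 ?(ltW p0) ?(ltW k1) ?(ltW k2)//.
rewrite -powRrM in h1 h2; split.
  by rewrite (le_trans _ lo)// -mulrA ler_wpM2l// ltW.
by rewrite (le_trans hi)// -mulrA ler_wpM2l// ltW.
Unshelve. all: by end_near. Qed.

Lemma error_rate (alpha : R) (err : R -> R) (rk : nat -> R) : 0 < alpha ->
  rk =O_\oo (fun n : nat => n%:R^-1 `^ alpha) ->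
  (\forall d \near 0^'+, 0 <= err d <= rk (nt d)) ->
  err =O_ (0^'+) (fun d => d `^ (rate_exponent * alpha)).
Proof.
move=> alpha0 /eqO_exP[C C0 hC] herr.
have [k [k1 k2] hk] := n_tilde_rate; have hC' := near_n_tilde hC.
apply/eqO_exP; exists (C * k.2 `^ alpha); first by rewrite mulr_gt0 ?powR_gt0.
near=> d.
have /andP[e0 er] : 0 <= err d <= rk (nt d) by near: d.
rewrite (ger0_norm e0) (ger0_norm (powR_ge0 _ _)) (le_trans er)//.
rewrite (le_trans (ler_norm _))//.
have : `|rk (nt d)| <= C * `|u d `^ alpha| by near: d.
rewrite (ger0_norm (powR_ge0 _ _)) => /le_trans; apply.
rewrite -mulrA ler_wpM2l ?(ltW C0)//.
have hu : k.1 * d `^ rate_exponent <= u d <= k.2 * d `^ rate_exponent by near: d.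
have /andP[_] : k.1 `^ alpha * (d `^ rate_exponent) `^ alpha <= u d `^ alpha <=
    k.2 `^ alpha * (d `^ rate_exponent) `^ alpha.
  apply: powR_sandwich hu; rewrite ?powR_ge0 ?(ltW alpha0) ?(ltW k1) ?(ltW k2)//.
by rewrite -powRrM.
Unshelve. all: by end_near. Qed.

End parameter_choice.

(** * The rate in terms of the noise level *)

Unset Implicit Arguments.

Theorem theorem4 (R : realType) (dT dX dO : measure_display)
  (T : measurableType dT) (X : measurableType dX)
  (mu : {measure set T -> \bar R})
  (rho : probability (X * measurableTypeR R)%type R)
  (nu : probability X R) (hnu : is_marginal rho nu)
  (I : choiceType) (e : I -> X -> R) (he : orthonormal_basis nu e)
  (A : (T -> R) -> (X -> R)) (hA : bounded_linear_L2 mu nu A)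
  (ell : R -> X -> T -> R) (hell : regularization_family mu nu A ell)
  (y : X -> R) (hy : y \in Lfun nu 2%:E)
  (fdag : T -> R) (hfdag : generalized_solution mu nu A y fdag)
  (hAfdag : A fdag = y %[ae nu])
  (sigma : R) (hrho : regression_model rho nu y sigma)
  (Om : measurableType dO) (P : probability Om R)
  (Z : nat -> {RV P >-> (X * measurableTypeR R)%type})
  (hZ : iid_sample rho Z)
  (alpha p gamma : R) (halpha : 0 < alpha) (hp : 0 < p) (hgamma : 0 < gamma)
  (Ln : nat -> R) (Ln_gt0 : forall n, (0 < n)%N -> 0 < Ln n)
  (hLn : Ln =Theta_\oo (fun n : nat => n%:R `^ (- p)))
  (heps : eps mu nu e ell y fdag =Theta_ (0^'+) (fun l => l `^ gamma))
  (hfin : \forall n \near \oo, (risk mu Z (ell (Ln n)) fdag n < +oo)%E)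
  (hrate : (fun n => fine (risk mu Z (ell (Ln n)) fdag n))
     =O_\oo (fun n : nat => n%:R^-1 `^ alpha))
  (Ld : R -> R) (Ld_gt0 : forall delta, 0 < delta -> 0 < Ld delta)
  (hLd : associated_choice sigma (eps mu nu e ell y fdag) Ln Ld)
  (yd : R -> X -> R)
  (hyd_L2 : forall delta, 0 < delta -> yd delta \in Lfun nu 2%:E)
  (hyd : forall delta, 0 < delta -> L2norm nu (yd delta \- y) <= delta) :
  let err2 := fun delta =>
    L2norm mu (kernel_op nu (ell (Ld delta)) (yd delta) \- fdag) ^+ 2 in
  (2^-1 <= p * gamma ->
     err2 =O_ (0^'+) (fun delta => delta `^ (2 * alpha)) /\
     Ld =Theta_ (0^'+) (fun delta => delta `^ (2 * p))) /\
  (p * gamma < 2^-1 ->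
     err2 =O_ (0^'+) (fun delta => delta `^ (alpha / (1 - p * gamma))) /\
     Ld =Theta_ (0^'+) (fun delta => delta `^ (p / (1 - p * gamma)))).
Proof.
move=> err2; have hf : fdag \in Lfun mu 2%:E by case: hfdag => -[].
set ep := eps mu nu e ell y fdag in heps hLd *.
pose H l := HSnorm mu e (kernel_op nu (ell l)).
pose bias l := L2norm mu (kernel_op nu (ell l) y \- fdag).
have ep0 l : 0 <= ep l.
  by rewrite /ep /eps mulr_ge0 ?L2norm_ge0// invr_ge0 sqrtr_ge0.
have s0 := associated_sigma_neq0 hLd.
have herr : \forall d \near 0^'+, 0 <= err2 d <=
    fine (risk mu Z (ell (Ln (n_tilde sigma ep Ld d))) fdag (n_tilde sigma ep Ld d)).
  have [b [b1 b2] hb] := ep_Ln_sandwich ep0 hp hgamma Ln_gt0 hLn heps.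
  have hb' := near_n_tilde ep0 hLd hb; have hfin' := near_n_tilde ep0 hLd hfin.
  have ac := assoc_choice hLd.
  near=> d.
  have d0 : 0 < d by near: d; exact: nbhs_right_gt.
  have n0 : (0 < n_tilde sigma ep Ld d)%N by near: d; exact: (n_tilde_large ep0 hLd 1).
  have LdE : Ld d = Ln (n_tilde sigma ep Ld d) by near: d.
  have [lo _] := n_tilde_bounds ep0 hLd d0 n0.
  have rfin : (risk mu Z (ell (Ln (n_tilde sigma ep Ld d))) fdag
      (n_tilde sigma ep Ld d) < +oo)%E by near: d.
  have /andP[epos _] : b.1 * (n_tilde sigma ep Ld d)%:R^-1 `^ (p * gamma) <=
      ep (Ln (n_tilde sigma ep Ld d)) <=
      b.2 * (n_tilde sigma ep Ld d)%:R^-1 `^ (p * gamma) by near: d.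
  rewrite sqr_ge0/= /err2 -LdE in rfin epos *.
  move: (n_tilde sigma ep Ld d) n0 lo rfin epos {LdE} => n n0 lo rfin epos.
  have l0 := Ld_gt0 d d0; set l := Ld d in lo rfin epos l0 *.
  have {}epos : 0 < ep l.
    by apply: lt_le_trans epos; rewrite mulr_gt0// powR_gt0// invr_gt0 ltr0n.
  have hk := reg_kernel hell l0; have kL2 := reg_L2 hell l0.
  have H0 : H l != 0.
    by apply/eqP => H0; move: epos; rewrite /ep /eps -/(H l) H0 invr0 mulr0 ltxx.
  have biasE : bias l = ep l * H l by rewrite /ep /eps divfK.
  have := risk_ge hnu he hy hrho hZ hf hk kL2 n0 s0 H0 rfin.
  rewrite -/(bias l) -/(H l); apply: le_trans.
  have hz := Lfun2B (hyd_L2 d d0) hy.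
  have h1 : L2norm mu (kernel_op nu (ell l) (yd d) \- fdag) <= H l * d + bias l.
    have -> : kernel_op nu (ell l) (yd d) \- fdag =
        kernel_op nu (ell l) (yd d \- y) \+ (kernel_op nu (ell l) y \- fdag).
      rewrite (kernel_opB hk)//; last exact: hyd_L2.
      by apply/funext => t /=; rewrite addrA subrK.
    rewrite (le_trans (L2normD (kL2 _ hz) (Lfun2B (kL2 _ hy) hf)))// lerD2r.
    rewrite (le_trans (L2norm_kernel_op_le he hk kL2 H0 hz (reg_bounded hell l0)))//.
    by rewrite ler_wpM2l ?sqrtr_ge0// hyd.
  rewrite (@le_trans _ _ ((H l * d + bias l) ^+ 2))//.
    by rewrite lerXn2r ?nnegrE ?L2norm_ge0// addr_ge0 ?L2norm_ge0// mulr_ge0 ?sqrtr_ge0// ltW.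
  rewrite biasE (_ : (_ + _) ^+ 2 = H l ^+ 2 * (d ^+ 2 + 2 * d * ep l) + (ep l * H l) ^+ 2).
    by rewrite addrC lerD2l mulrC ler_wpM2r ?sqr_ge0.
  by ring.
have hLdr := Ld_rate ep0 hLd hp hgamma Ln_gt0 hLn heps.
have herrr := error_rate ep0 hLd hp hgamma Ln_gt0 hLn heps halpha hrate herr.
split => pg; move: hLdr herrr; rewrite /rate_exponent.
  by rewrite pg.
by rewrite leNgt pg/= ![_^-1 * _]mulrC.
Unshelve. all: by end_near. Qed.
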